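(* Let $|\psi\rangle$ be an $n$-qubit stabilizer state and $\mathbb{D}$ a set of detectors for $|\psi\rangle$. Let $G'_1,\dots,G'_m$ be error generators (real linear combinations of elementary error generators), and for $\epsilon\in\mathbb{R}$ let $\mathcal{E}'_i=\exp(\epsilon G'_i)$ be the error channels of the circuit layers propagated to the end of the circuit, so that the circuit error channel is $\mathcal{E}_c=\mathcal{E}'_m\mathcal{E}'_{m-1}\cdots\mathcal{E}'_1$. Let $E_1$ be the set of all DEM events $\Delta(P)$, where $P$ is a Pauli appearing among the indices of the elementary error generators occurring in $G'_1,\dots,G'_m$. For $k\ge1$ let $E_k$ be the set of DEM events that can be expressed as the symmetric difference of up to $k$ DEM events in $E_1$. Then for every $k\ge 1$ the DEM (with possibly negative event rates) describing the circuit's detection histories to order $k$ in the elementary error generator rates contains only events in $E_k$. That is, this order-$k$ DEM $(p_D)_{\emptyset\neq D\subseteq\mathbb{D}}$ exists and satisfies $p_D=0$ for every nonempty $D\subseteq\mathbb{D}$ with $D\notin E_k$.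
   Context: Paulis: $n$-qubit Pauli operators are tensor products of $I,X,Y,Z$, possibly with a sign $\pm1$. Detectors: $|\psi\rangle$ is the state produced by the error-free circuit (with measurements deferred to the end). A detector is a signed Pauli operator $P$ with $\langle\psi|P|\psi\rangle=1$. $\mathbb{D}$ is a finite set of pairwise commuting, multiplicatively independent detectors. For a Pauli $Q$, $\Delta(Q)=\{P\in\mathbb{D}:[P,Q]\neq0\}$, the DEM event caused by $Q$. A DEM event is a subset of $\mathbb{D}$. Detection history: the subset $S\subseteq\mathbb{D}$ of detectors with measured outcome $-1$. It has probability $\Pr_\epsilon(S)=\mathrm{Tr}(\Pi_S\,\mathcal{E}_c[|\psi\rangle\langle\psi|])$, where $\Pi_S=\prod_{P\in S}\frac{I-P}{2}\prod_{P\in\mathbb{D}\setminus S}\frac{I+P}{2}$. Elementary error generators are the following linear maps, indexed by non-identity Paulis $P$ (or pairs of distinct non-identity Paulis $P,Q$): $H_P[\rho]=-i[P,\rho]$; $S_P[\rho]=P\rho P-\rho$; $C_{P,Q}[\rho]=P\rho Q+Q\rho P-\frac12\{\{P,Q\},\rho\}$; $A_{P,Q}[\rho]=i\left(P\rho Q-Q\rho P+\frac12\{[P,Q],\rho\}\right)$. The coefficients of a generator in these maps are its rates. The parameter $\epsilon$ scales all rates uniformly and keeps track of the order in the rates. Order-$k$ DEM: a DEM with event rates $(p_D)_{\emptyset\ne D\subseteq\mathbb{D}}$ assigns to a detection history $S$ the (quasi-)probability $\sum_{F}\prod_{D\in F}p_D\prod_{D\notin F}(1-p_D)$, the sum being over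 all sets $F$ of nonempty subsets of $\mathbb{D}$ whose symmetric difference is $S$ (each event occurs independently, and the history is the symmetric difference of the events that occur). The DEM describing the detection histories to order $k$ is the family of real polynomials $p_D=p_D(\epsilon)$ of degree at most $k$ with $p_D(0)=0$ such that the quasi-probability of every $S\subseteq\mathbb{D}$ equals $\Pr_\epsilon(S)+O(\epsilon^{k+1})$ as $\epsilon\to0$. Negative rates are allowed. The DEM contains the event $D$ if $p_D$ is not the zero polynomial. *)

(* Defs.v *)
From HB Require Import structures.
From mathcomp Require Import all_boot all_order all_algebra.
From mathcomp Require Import complex.
From mathcomp Require Import all_classical all_reals all_analysis.

Set Implicit Arguments.
Unset Strict Implicit.
Unset Printing Implicit Defensive.

Import Order.TTheory GRing.Theory Num.Theory.
Import numFieldNormedType.Exports.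

Local Open Scope ring_scope.
Local Open Scope complex_scope.

Inductive pauli1 : Type := PI | PX | PY | PZ.

Definition pauli1_code (p : pauli1) : bool * bool :=
  match p with
  | PI => (false, false) | PX => (true, false)
  | PY => (true, true) | PZ => (false, true)
  end.

Definition pauli1_decode (b : bool * bool) : pauli1 :=
  match b with
  | (false, false) => PI | (true, false) => PX
  | (true, true) => PY | (false, true) => PZ
  end.

Lemma pauli1_codeK : cancel pauli1_code pauli1_decode.
Proof. by case. Qed.

HB.instance Definition _ := Equality.copy pauli1 (can_type pauli1_codeK).
HB.instance Definition _ := Choice.copy pauli1 (can_type pauli1_codeK).
HB.instance Definition _ := Countable.copy pauli1 (can_type pauli1_codeK).
HB.instance Definition _ := Finite.copy pauli1 (can_type pauli1_codeK).

(* (s, w) is the Pauli (-1)^s w_0 (x) ... (x) w_(n-1). *)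
Definition pauli (n : nat) : Type := (bool * {ffun 'I_n -> pauli1})%type.
HB.instance Definition _ n :=
  Finite.copy (pauli n) (bool * {ffun 'I_n -> pauli1})%type.

(* The computational basis is indexed by bit strings, so this is 2 ^ n. *)
Definition qdim (n : nat) : nat := #|{ffun 'I_n -> 'I_2}|.

Definition basis_string n (x : 'I_(qdim n)) : {ffun 'I_n -> 'I_2} := enum_val x.

Section Operators.
Variable R : realType.

Definition pauli1_mx (p : pauli1) : 'M[R[i]]_2 :=
  match p with
  | PI => 1%:M
  | PX => \matrix_(a, b) (a != b)%:R
  | PY => \matrix_(a, b) ((a != b)%:R * (-1) ^+ b * 'i)
  | PZ => \matrix_(a, b) ((a == b)%:R * (-1) ^+ b)
  end.

(* Entries of the n-fold Kronecker product, in the basis of bit strings. *)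
Definition pauli_mx n (P : pauli n) : 'M[R[i]]_(qdim n) :=
  (-1) ^+ P.1 *: \matrix_(x, y)
    \prod_(j < n) pauli1_mx (P.2 j) (basis_string x j) (basis_string y j).

Definition adjmx p q (A : 'M[R[i]]_(p, q)) : 'M[R[i]]_(q, p) :=
  (map_mx (@conjc R) A)^T.

(* psi is a unit vector and some set of Paulis has the line through psi as its
   joint +1 eigenspace. *)
Definition stabilizer_state n (psi : 'cV[R[i]]_(qdim n)) : Prop :=
  adjmx psi *m psi = 1%:M /\
  exists T : {set pauli n}, forall phi : 'cV[R[i]]_(qdim n),
    (forall P, P \in T -> pauli_mx P *m phi = phi) <->
    (exists c : R[i], phi = c *: psi).

Definition detector n (psi : 'cV[R[i]]_(qdim n)) (P : pauli n) : Prop :=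
  adjmx psi *m pauli_mx P *m psi = 1%:M.

(* In the independence clause the products run in enumeration order, which is
   immaterial for commuting factors; a product equal to -1 is ruled out by the
   first clause. *)
Definition detector_set n (psi : 'cV[R[i]]_(qdim n)) (DD : {set pauli n}) :
    Prop :=
  [/\ forall P, P \in DD -> detector psi P,
      forall P Q, P \in DD -> Q \in DD -> comm_mx (pauli_mx P) (pauli_mx Q)
    & forall F : {set pauli n}, F \subset DD -> F != finset.set0 ->
        \prod_(P in F) pauli_mx P != 1%:M].

Definition dem_event n (DD : {set pauli n}) (Q : pauli n) : {set pauli n} :=
  [set P in DD | ~~ comm_mxb (pauli_mx P) (pauli_mx Q)]%SET.

End Operators.

Definition symdiff (T : finType) (A B : {set T}) : {set T} :=
  ((A :\: B) :|: (B :\: A))%SET.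

Definition symdiffs (T : finType) (F : {set {set T}}) : {set T} :=
  \big[@symdiff T/finset.set0]_(D in F) D.

Definition events n (DD : {set pauli n}) : {set {set pauli n}} :=
  (powerset DD :\ finset.set0)%SET.

Inductive elem_label (n : nat) : Type :=
  | HGen (P : pauli n)
  | SGen (P : pauli n)
  | CGen (P Q : pauli n)
  | AGen (P Q : pauli n).

Definition elem_code n (e : elem_label n) :
    ((pauli n + pauli n) + (pauli n * pauli n + pauli n * pauli n))%type :=
  match e with
  | HGen P => inl (inl P) | SGen P => inl (inr P)
  | CGen P Q => inr (inl (P, Q)) | AGen P Q => inr (inr (P, Q))
  end.

Definition elem_decode n
    (s : ((pauli n + pauli n) + (pauli n * pauli n + pauli n * pauli n))%type) :
    elem_label n :=
  match s with
  | inl (inl P) => HGen P | inl (inr P) => SGen P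
  | inr (inl (P, Q)) => CGen P Q | inr (inr (P, Q)) => AGen P Q
  end.

Lemma elem_codeK n : cancel (@elem_code n) (@elem_decode n).
Proof. by case. Qed.

HB.instance Definition _ n :=
  Equality.copy (elem_label n) (can_type (@elem_codeK n)).
HB.instance Definition _ n :=
  Choice.copy (elem_label n) (can_type (@elem_codeK n)).
HB.instance Definition _ n :=
  Countable.copy (elem_label n) (can_type (@elem_codeK n)).
HB.instance Definition _ n :=
  Finite.copy (elem_label n) (can_type (@elem_codeK n)).

(* Both +1 and -1 count as the identity. *)
Definition nonid n (P : pauli n) : bool := P.2 != [ffun=> PI].

Definition elem_ok n (e : elem_label n) : bool :=
  match e with
  | HGen P | SGen P => nonid P
  | CGen P Q | AGen P Q => [&& nonid P, nonid Q & P != Q]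
  end.

Definition elem_gen (n : nat) : Type := {e : elem_label n | elem_ok e}.
HB.instance Definition _ n :=
  Finite.copy (elem_gen n) {e : elem_label n | elem_ok e}.

Definition indices n (e : elem_label n) : {set pauli n} :=
  match e with
  | HGen P | SGen P => [set P]%SET
  | CGen P Q | AGen P Q => [set P; Q]%SET
  end.

Section ErrorModel.
Variable R : realType.

Definition commut N (A B : 'M[R[i]]_N) : 'M[R[i]]_N := A *m B - B *m A.
Definition acommut N (A B : 'M[R[i]]_N) : 'M[R[i]]_N := A *m B + B *m A.

Definition elem_map n (e : elem_label n) (rho : 'M[R[i]]_(qdim n)) :
    'M[R[i]]_(qdim n) :=
  let mx := @pauli_mx R n in
  match e with
  | HGen P => - 'i *: commut (mx P) rho
  | SGen P => mx P *m rho *m mx P - rho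
  | CGen P Q => mx P *m rho *m mx Q + mx Q *m rho *m mx P
      - 2^-1 *: acommut (acommut (mx P) (mx Q)) rho
  | AGen P Q => 'i *: (mx P *m rho *m mx Q - mx Q *m rho *m mx P
      + 2^-1 *: acommut (commut (mx P) (mx Q)) rho)
  end.

(* A formal real linear combination, given by its rates. *)
Definition error_gen (n : nat) : Type := {ffun elem_gen n -> R}.

Definition gen_map n (g : error_gen n) (rho : 'M[R[i]]_(qdim n)) :
    'M[R[i]]_(qdim n) :=
  \sum_(e : elem_gen n) (g e)%:C *: elem_map (val e) rho.

(* exp(Phi) = sum_j Phi^j / j!, the series being evaluated at rho; R[i]^o is
   R[i] with the topology of its norm. *)
Definition superop_exp N (Phi : 'M[R[i]]_N -> 'M[R[i]]_N) (rho : 'M[R[i]]_N) :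
    'M[R[i]]_N :=
  limn (fun M : nat =>
    (\sum_(j < M) (j`!%:R^-1 : R[i]) *: iter j Phi rho : 'M[R[i]^o]_N)).

Definition error_channel n (g : error_gen n) (eps : R)
    (rho : 'M[R[i]]_(qdim n)) : 'M[R[i]]_(qdim n) :=
  superop_exp (fun sigma => eps%:C *: gen_map g sigma) rho.

(* The head of the sequence is the layer that acts first. *)
Definition circuit_channel n (G : seq (error_gen n)) (eps : R)
    (rho : 'M[R[i]]_(qdim n)) : 'M[R[i]]_(qdim n) :=
  foldl (fun sigma g => error_channel g eps sigma) rho G.

Definition history_proj n (DD S : {set pauli n}) : 'M[R[i]]_(qdim n) :=
  (\prod_(P in S) (2^-1 *: (1%:M - pauli_mx R P))) *
  (\prod_(P in (DD :\: S)%SET) (2^-1 *: (1%:M + pauli_mx R P))).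

Definition history_prob n (psi : 'cV[R[i]]_(qdim n)) (DD : {set pauli n})
    (G : seq (error_gen n)) (eps : R) (S : {set pauli n}) : R[i] :=
  \tr (history_proj DD S *m circuit_channel G eps (psi *m adjmx psi)).

Definition dem_prob n (DD : {set pauli n}) (p : {set pauli n} -> R)
    (S : {set pauli n}) : R :=
  \sum_(F : {set {set pauli n}} | (F \subset events DD) && (symdiffs F == S))
    (\prod_(D in F) p D) * (\prod_(D in (events DD :\: F)%SET) (1 - p D)).

(* Only the values of p on events DD are constrained. The modulus is that of
   the complex difference: history_prob is not assumed to be real. *)
Definition order_dem n (psi : 'cV[R[i]]_(qdim n)) (DD : {set pauli n})
    (G : seq (error_gen n)) (k : nat) (p : {set pauli n} -> {poly R}) : Prop :=
  (forall D, D \in events DD -> (size (p D) <= k.+1)%N /\ (p D).[0] = 0) /\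
  (forall S : {set pauli n}, S \subset DD ->
     (fun eps : R => Normc.normc
        ((dem_prob DD (fun D => (p D).[eps]) S)%:C
           - history_prob psi DD G eps S) : R^o)
     =O_ (nbhs (0 : R)) (fun eps : R => eps ^+ k.+1 : R^o)).

Definition elem_events n (DD : {set pauli n}) (G : seq (error_gen n)) :
    {set {set pauli n}} :=
  [set dem_event R DD P | P in [pred P : pauli n |
     has (fun g : error_gen n =>
       [exists e : elem_gen n, (g e != 0) && (P \in indices (val e))]) G]]%SET.

Definition elem_events_upto n (DD : {set pauli n}) (G : seq (error_gen n))
    (k : nat) : {set {set pauli n}} :=
  [set symdiffs F | F : {set {set pauli n}} in
     [pred F : {set {set pauli n}} |
       (F \subset elem_events DD G) && (#|F| <= k)%N]]%SET.

End ErrorModel.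

(* Main.v *)
(** Expanding the exponentials, the coefficient of [eps ^ j] in the final state
    is a combination of operators [A rho B], where [A] and [B] are words in the
    index Paulis with at most [2 j] letters in total. Since the detectors fix
    [psi], [A rho] and [rho B] are eigenvectors of every projector [Pi_S]:
    [Tr (Pi_S A rho B)] vanishes unless [S] is the symmetric difference of the
    events of the letters of [A], and also that of the letters of [B]. The
    shorter word has at most [j] letters, so [S] lies in [E_j].

    In the DEM, the quasi-probability of a nonempty history [S] is [p_S] plus
    terms at least quadratic in the rates. Hence the order-[k] rates are the
    unique fixed point, modulo [eps ^ (k+1)], of a contraction. Because [E_i]
    and [E_j] combine into [E_(i+j)], this contraction preserves the property
    that the coefficient of [eps ^ j] in [p_D] vanishes for [D] outside [E_j]. *)

Require Import Defs.
From HB Require Import structures.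
From mathcomp Require Import all_boot all_order all_algebra.
From mathcomp Require Import ring lra zify.
From mathcomp Require Import complex.
From mathcomp Require Import all_classical all_reals all_analysis.

Set Implicit Arguments.
Unset Strict Implicit.
Unset Printing Implicit Defensive.

Import Order.TTheory GRing.Theory Num.Theory.
Import numFieldNormedType.Exports.

Local Open Scope ring_scope.

(** * Symmetric differences *)

Section SymmetricDifference.
Variable T : finType.
Implicit Types A B D S : {set T}.

Lemma in_symdiff A B x : (x \in symdiff A B) = (x \in A) (+) (x \in B).
Proof. by rewrite !inE; case: (x \in A); case: (x \in B). Qed.

Lemma symdiffA : associative (@symdiff T).
Proof. by move=> A B C; apply/setP=> x; rewrite !in_symdiff addbA. Qed.

Lemma symdiffC : commutative (@symdiff T).
Proof. by move=> A B; apply/setP=> x; rewrite !in_symdiff addbC. Qed.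

Lemma symdiff0s : left_id finset.set0 (@symdiff T).
Proof. by move=> A; apply/setP=> x; rewrite in_symdiff inE. Qed.

HB.instance Definition _ := Monoid.isComLaw.Build {set T} finset.set0
  (@symdiff T) symdiffA symdiffC symdiff0s.

Lemma symdiffss A : symdiff A A = finset.set0.
Proof. by apply/setP=> x; rewrite in_symdiff inE addbb. Qed.

Lemma symdiff_sub A B S : A \subset S -> B \subset S -> symdiff A B \subset S.
Proof.
move=> /fintype.subsetP AS /fintype.subsetP BS; apply/fintype.subsetP=> x.
rewrite in_symdiff.
by case xA: (x \in A) => /= xB; [apply: AS | apply: BS].
Qed.

Lemma symdiffs_sub (F : {set {set T}}) S :
  (forall D, D \in F -> D \subset S) -> symdiffs F \subset S.
Proof.
move=> FS; rewrite /symdiffs; elim/big_ind: _ => //.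
  exact: finset.sub0set.
by move=> A B; apply: symdiff_sub.
Qed.

Lemma symdiffs0 : symdiffs finset.set0 = finset.set0 :> {set T}.
Proof. by rewrite /symdiffs big_set0. Qed.

Lemma symdiffs1 D : symdiffs [set D]%SET = D.
Proof. by rewrite /symdiffs big_set1. Qed.

(** With [E] the set of elementary events this is [elem_events_upto] up to conversion, which the
    final step of the theorem relies on. *)
Definition symdiffs_upto (E : {set {set T}}) (j : nat) : {set {set T}} :=
  [set symdiffs F | F : {set {set T}} in
     [pred F : {set {set T}} | (F \subset E) && (#|F| <= j)%N]]%SET.

Variable E : {set {set T}}.

Lemma symdiffs_uptoP j S : reflect
  (exists F : {set {set T}}, [/\ F \subset E, (#|F| <= j)%N & S = symdiffs F])
  (S \in symdiffs_upto E j).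
Proof.
apply: (iffP imsetP) => [[F]|[F [FE Fj ->]]].
  by rewrite inE => /andP[FE Fj] ->; exists F.
by exists F => //; rewrite inE FE.
Qed.

(** If [D] already belongs to the family, it cancels and the family shrinks; otherwise the family
    gains one member. *)
Lemma symdiffs_upto_add1 j D S : D \in E -> S \in symdiffs_upto E j ->
  symdiff D S \in symdiffs_upto E j.+1.
Proof.
move=> DE /symdiffs_uptoP[F [FE Fj ->]]; apply/symdiffs_uptoP.
have [DF|DF] := boolP (D \in F).
  exists (F :\ D)%SET; split.
  - exact: fintype.subset_trans (finset.subsetDl _ _) FE.
  - by apply: leq_trans (subset_leq_card (finset.subsetDl _ _)) _; exact: leqW.
  - by rewrite /symdiffs (big_setD1 D) //= symdiffA symdiffss symdiff0s.
exists (D |: F)%SET; split.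
- by rewrite finset.subUset finset.sub1set DE.
- by rewrite cardsU1 DF.
- by rewrite /symdiffs big_setU1.
Qed.

(** Pauli words yield lists of events with repetitions, whereas [symdiffs_upto] speaks of sets of
    events. Cancellation of repeated events bridges the two. *)
Lemma symdiffs_upto_seq j (s : seq {set T}) : (size s <= j)%N ->
  {subset s <= E} -> \big[@symdiff T/finset.set0]_(D <- s) D \in
    symdiffs_upto E j.
Proof.
elim: s j => [|D s IHs] j.
  move=> _ _; rewrite big_nil; apply/symdiffs_uptoP.
  by exists finset.set0; rewrite finset.sub0set cards0 symdiffs0.
case: j => // j /= sj sE; rewrite big_cons symdiffs_upto_add1 ?IHs //.
  by apply: sE; rewrite mem_head.
by move=> A As; apply: sE; rewrite inE As orbT.
Qed.

Lemma symdiffs_upto_add i j A B : A \in symdiffs_upto E i ->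
  B \in symdiffs_upto E j -> symdiff A B \in symdiffs_upto E (i + j).
Proof.
move=> /symdiffs_uptoP[F [/fintype.subsetP FE Fi ->]].
move=> /symdiffs_uptoP[F' [/fintype.subsetP FE' Fj ->]].
rewrite /symdiffs -!big_enum -big_cat symdiffs_upto_seq //.
  by rewrite size_cat -!cardE leq_add.
by move=> D; rewrite mem_cat !mem_enum => /orP[/FE|/FE'].
Qed.

Lemma symdiffs_uptoW i j A : (i <= j)%N -> A \in symdiffs_upto E i ->
  A \in symdiffs_upto E j.
Proof.
move=> ij /symdiffs_uptoP[F [FE Fi ->]]; apply/symdiffs_uptoP; exists F.
by split=> //; apply: leq_trans ij.
Qed.

Lemma symdiffs_upto0 j : finset.set0 \in symdiffs_upto E j.
Proof. by have := @symdiffs_upto_seq j [::]; rewrite big_nil; apply. Qed.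

Lemma symdiffs_upto_at0 S : S \in symdiffs_upto E 0 -> S = finset.set0.
Proof.
move=> /symdiffs_uptoP[F [_]]; rewrite leqn0 cards_eq0 => /eqP -> ->.
exact: symdiffs0.
Qed.

End SymmetricDifference.

(** * Detector error models as polynomials *)

Section DetectorErrorModel.
Variables (K : comNzRingType) (T : finType).

Definition dem_term (ev : {set {set T}}) (p : {set T} -> K)
    (F : {set {set T}}) : K :=
  (\prod_(D in F) p D) * (\prod_(D in (ev :\: F)%SET) (1 - p D)).

Definition dem_value (ev : {set {set T}}) (p : {set T} -> K) (S : {set T}) :
    K :=
  \sum_(F : {set {set T}} | (F \subset ev) && (symdiffs F == S))
    dem_term ev p F.

(** Grouping the families [F] by their symmetric difference turns the sum into the expansion of the
    product of all [p D + (1 - p D)]. *)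
Lemma sum_dem_value (ev : {set {set T}}) (p : {set T} -> K) (DD : {set T}) :
  (forall D, D \in ev -> D \subset DD) ->
  \sum_(S : {set T} | S \subset DD) dem_value ev p S = 1.
Proof.
move=> evDD; have -> : \sum_(S : {set T} | S \subset DD) dem_value ev p S =
    \sum_(F : {set {set T}} | F \subset ev) dem_term ev p F.
  rewrite [RHS](@partition_big _ _ _ _ _ _ _ (@symdiffs T)
    (fun S : {set T} => S \subset DD)) // => F /fintype.subsetP Fev.
  by apply: symdiffs_sub => D /Fev /evDD.
(* Rates are extended by zero outside [ev], so that the product can run over the whole type;
   families not contained in [ev] then contribute nothing. *)
pose P D := if D \in ev then p D else 0.
transitivity (\prod_D (P D + (1 - P D))); last first.
  by apply: big1 => D _; rewrite addrC subrK.
rewrite bigA_distr [RHS](bigID (fun F : {set {set T}} => F \subset ev)) /=.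
rewrite [X in _ = _ + X]big1 ?addr0 => [|F]; last first.
  case/fintype.subsetPn=> D DF Dev.
  by rewrite (bigD1 D) //= DF /P (negPf Dev) mul0r.
apply: eq_bigr => F Fev; rewrite [RHS](bigID (mem F)) /=; congr (_ * _).
  apply: eq_bigr => D DF; rewrite DF /P.
  by rewrite (fintype.subsetP Fev).
rewrite big_mkcond [RHS]big_mkcond; apply: eq_bigr => D _; rewrite !inE.
by case: (D \in F); rewrite //= /P; case: (D \in ev) => //; rewrite subr0.
Qed.

End DetectorErrorModel.

(** * Polynomial rates and the X-adic contraction *)

Section PolynomialModel.
Variables (K : fieldType) (T : finType).
Implicit Types (f g : {poly K}) (p q : {set T} -> {poly K}).

Lemma dvdXnP j f : reflect (forall i, (i < j)%N -> f`_i = 0) ('X^j %| f).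
Proof.
apply: (iffP idP) => [/dvdpP[g ->] i ij|f0]; first by rewrite coefMXn ij.
rewrite -(poly_take_drop j f) (_ : take_poly j f = 0) ?add0r ?dvdp_mull //.
by apply/polyP=> i; rewrite coef_take_poly coef0; case: ifP => // /f0.
Qed.

Lemma dvdX_coef0 f : ('X %| f) = (f`_0 == 0).
Proof.
rewrite -['X]expr1; apply/dvdXnP/eqP => [->//|f0 i].
by rewrite ltnS leqn0 => /eqP->.
Qed.

Lemma dvdXn_take j f : 'X^j %| take_poly j f - f.
Proof.
by apply/dvdXnP=> i ij; rewrite coefB coef_take_poly ij subrr.
Qed.

Lemma dvdp_mul_cong (d f f' g g' : {poly K}) :
  d %| f - f' -> d %| g - g' -> d %| f * g - f' * g'.
Proof.
move=> df dg; rewrite (_ : _ - _ = f * (g - g') + (f - f') * g'); last by ring.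
by apply: dvdp_add; [apply: dvdp_mull | apply: dvdp_mulr].
Qed.

Lemma dvdp_prod_cong (d : {poly K}) (I : finType) (P : pred I)
    (f g : I -> {poly K}) : (forall i, P i -> d %| f i - g i) ->
  d %| \prod_(i | P i) f i - \prod_(i | P i) g i.
Proof.
move=> dfg; elim/big_rec2: _ => [|i x y Pi]; first by rewrite subrr dvdp0.
exact/dvdp_mul_cong/dfg.
Qed.

(** The extra power of ['X] arises because each difference is multiplied by a factor without
    constant term. *)
Lemma dvdXn_mul_cong j f f' g g' : 'X %| f -> 'X %| g' ->
  'X^j %| f - f' -> 'X^j %| g - g' -> 'X^(j.+1) %| f * g - f' * g'.
Proof.
move=> Xf Xg df dg.
rewrite (_ : _ - _ = f * (g - g') + (f - f') * g'); last by ring.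
by rewrite exprS; apply: dvdp_add; [|rewrite mulrC]; exact: dvdp_mul.
Qed.

Section Contraction.
Variable ev : {set {set T}}.
Hypothesis ev0 : finset.set0 \notin ev.

(* The only term of [dem_value ev p S] that is linear in the rates is [p S], so
   [dem_value ev p S - p S] contracts X-adically. *)
Lemma dem_value_contract p q j S : S \in ev ->
  (forall D, D \in ev -> 'X %| p D) -> (forall D, D \in ev -> 'X %| q D) ->
  (forall D, D \in ev -> 'X^j %| p D - q D) ->
  'X^(j.+1) %| (dem_value ev p S - p S) - (dem_value ev q S - q S).
Proof.
move=> Sev Xp Xq pq.
have FS : ([set S]%SET \subset ev) && (symdiffs [set S]%SET == S).
  by rewrite finset.sub1set Sev symdiffs1 eqxx.
have pq1 (A : {set {set T}}) : A \subset ev ->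
    'X^j %| \prod_(D in A) (1 - p D) - \prod_(D in A) (1 - q D).
  move=> /fintype.subsetP Aev; apply: dvdp_prod_cong => D /Aev /pq.
  by rewrite -dvdpNr; congr (_ %| _); ring.
have devF F : (ev :\: F)%SET \subset ev by exact: finset.subsetDl.
rewrite /dem_value (bigD1 [set S]%SET) //=.
rewrite [in X in _ - X](bigD1 [set S]%SET) //=.
rewrite {1 3}/dem_term !big_set1.
set up := \prod_(D in _) _; set uq := \prod_(D in _) _.
set Rp := \sum_(F | _) _; set Rq := \sum_(F | _) _.
(* The family consisting of [S] alone contributes [p S * up]. Removing [p S] leaves the factor
   [up - 1], which has no constant term. *)
rewrite (_ : _ - _ = (p S * (up - 1) - q S * (uq - 1)) + (Rp - Rq));
  last by ring.
rewrite dvdp_add //.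
  apply: dvdXn_mul_cong; rewrite ?Xp ?pq //; last first.
    by rewrite (_ : _ - _ = up - uq) ?pq1 //; ring.
  have := @dvdp_prod_cong 'X _ (fun D => D \in (ev :\: [set S])%SET)
    (fun D => 1 - q D) (fun=> 1); rewrite big1_eq; apply => D.
  rewrite inE => /andP[_ /Xq]; rewrite -dvdpNr.
  by congr (_ %| _); ring.
rewrite /Rp /Rq -sumrB.
elim/big_ind: _ => [||F /andP[/andP[Fev /eqP FSeq] FnS]]; first exact: dvdp0.
  by move=> x y; apply: dvdp_add.
(* Every other family has at least two members: the empty one would give the empty history, and a
   singleton could only be that of [S]. The two rates [p D] and [p D'] provide the gain of one
   power. *)
have /set0Pn[D DF] : F != finset.set0.
  by apply: contraNneq ev0 => F0; rewrite -symdiffs0 -F0 FSeq.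
have /set0Pn[D' D'F] : (F :\ D)%SET != finset.set0.
  apply: contraNneq FnS => F0; rewrite -FSeq -(finset.setD1K DF) F0.
  by rewrite finset.setU0 symdiffs1.
rewrite /dem_term !(big_setD1 D DF) !(big_setD1 D' D'F) /= -!mulrA.
have Fev' := fintype.subsetP Fev.
have D'ev : D' \in ev by apply: Fev'; move: D'F; rewrite inE => /andP[].
apply: dvdXn_mul_cong; rewrite ?Xp ?pq ?Fev' ?dvdp_mulr ?Xq //.
apply: dvdp_mul_cong; rewrite ?pq //; apply: dvdp_mul_cong; last exact: pq1.
apply: dvdp_prod_cong => E; rewrite !inE => /andP[_ /andP[_ EF]].
exact/pq/Fev'.
Qed.

(** By the contraction, agreement modulo ['X^j] improves to agreement modulo ['X^(j.+1)] as long as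
    the values agree. The size bounds turn congruence modulo ['X^(k.+1)] into equality. *)
Lemma dem_value_inj p q k :
  (forall D, D \in ev -> (size (p D) <= k.+1)%N /\ 'X %| p D) ->
  (forall D, D \in ev -> (size (q D) <= k.+1)%N /\ 'X %| q D) ->
  (forall S, S \in ev -> 'X^(k.+1) %| dem_value ev p S - dem_value ev q S) ->
  {in ev, p =1 q}.
Proof.
move=> pP qP pq D Dev.
have pqj : forall j, (j <= k.+1)%N -> forall D, D \in ev ->
    'X^j %| p D - q D.
  elim=> [|j IHj] jk {}D {}Dev; first by rewrite expr0 dvd1p.
  rewrite (_ : p D - q D = (dem_value ev p D - dem_value ev q D) -
    ((dem_value ev p D - p D) - (dem_value ev q D - q D))); last by ring.
  rewrite dvdp_sub //.
    by apply: dvdp_trans (pq D Dev); apply: dvdp_exp2l.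
  apply: dem_value_contract => // [E /pP[]|E /qP[]|E Eev] //.
  by apply: IHj => //; apply: ltnW.
apply/polyP=> i; have [ik|ki] := ltnP i k.+1.
  apply/eqP; rewrite -subr_eq0 -coefB; apply/eqP.
  by have /dvdXnP -> := pqj k.+1 (leqnn _) D Dev.
have [sp _] := pP D Dev; have [sq _] := qP D Dev.
by rewrite !nth_default // (leq_trans _ ki).
Qed.

Variable E : {set {set T}}.

(** The invariant of the fixed-point argument: order in the rates bounds the number of elementary
    events needed. For nonempty [S] it forces a zero constant term, since order 0 only allows the
    empty set. *)
Definition supported f (S : {set T}) : Prop :=
  forall j, f`_j != 0 -> S \in symdiffs_upto E j.

Lemma supported_set0 f : supported f finset.set0.
Proof. by move=> j _; apply: symdiffs_upto0. Qed.

Lemma supportedD f g S : supported f S -> supported g S -> supported (f + g) S.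
Proof.
move=> fS gS j; have [f0|/fS//] := eqVneq f`_j 0.
by rewrite coefD f0 add0r; apply: gS.
Qed.

Lemma supportedN f S : supported f S -> supported (- f) S.
Proof. by move=> fS j; rewrite coefN oppr_eq0; apply: fS. Qed.

(** A nonzero coefficient of order [j] needs nonzero coefficients of orders [l] and [j - l] in the
    factors, and [symdiffs_upto_add] combines the corresponding histories. *)
Lemma supportedM f g A B : supported f A -> supported g B ->
  supported (f * g) (symdiff A B).
Proof.
move=> fA gB j; rewrite coefM => nz.
have [l] : exists l : 'I_j.+1, f`_l * g`_(j - l) != 0.
  apply: contrapT => /forallNP all0; move/eqP: nz; apply.
  by rewrite big1 // => l _; apply/eqP/negPn/negP/all0.
rewrite mulf_eq0 negb_or => /andP[/fA iA /gB iB].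
by have := symdiffs_upto_add iA iB; rewrite subnKC // -ltnS.
Qed.

Lemma supported_take k f S : supported f S -> supported (take_poly k f) S.
Proof.
by move=> fS j; rewrite coef_take_poly; case: ifP => [_ /fS|]; rewrite ?eqxx.
Qed.

Lemma dem_value_supported p S : (forall D, D \in ev -> supported (p D) D) ->
  supported (dem_value ev p S) S.
Proof.
move=> pD; rewrite /dem_value; elim/big_ind: _ => [j||F].
- by rewrite coef0 eqxx.
- by move=> f g; apply: supportedD.
move=> /andP[/fintype.subsetP Fev /eqP <-].
(* The product of the [1 - p D] is assigned to the empty history, where every polynomial is
   supported; the product of the rates carries [symdiffs F]. *)
rewrite -[symdiffs F](Monoid.mulm1 (@symdiff T)); apply: supportedM.
  rewrite /symdiffs; elim/big_rec2: _ => [|D f A DF].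
    exact: supported_set0.
  exact/supportedM/pD/Fev.
exact: supported_set0.
Qed.

(* A fixed point of this map reproduces [lam] modulo 'X^(k+1). *)
Definition dem_step (lam : {set T} -> {poly K}) k p (D : {set T}) : {poly K} :=
  take_poly k.+1 (lam D - (dem_value ev p D - p D)).

(** Iterating [dem_step] from zero, consecutive iterates agree to one more order each time, so
    iterate [k.+1] is a fixed point modulo ['X^(k.+1)]. Each step preserves [supported]. *)
Lemma dem_value_exists (lam : {set T} -> {poly K}) k :
  (forall S, S \in ev -> supported (lam S) S) ->
  exists p, forall D, D \in ev -> [/\ (size (p D) <= k.+1)%N, 'X %| p D,
    supported (p D) D & 'X^(k.+1) %| dem_value ev p D - lam D].
Proof.
move=> lamS; pose it i := iter i (dem_step lam k) (fun=> 0).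
have itS i D : D \in ev -> supported (it i D) D.
  elim: i D => [|i IHi] D Dev j /=; first by rewrite coef0 eqxx.
  apply: supported_take; apply: supportedD; first exact: lamS.
  apply/supportedN/supportedD; last exact/supportedN/IHi.
  exact: dem_value_supported.
have itX i D : D \in ev -> 'X %| it i D.
  move=> Dev; rewrite dvdX_coef0; apply/negPn/negP => /(itS _ _ Dev).
  by move/symdiffs_upto_at0 => D0; move: Dev; rewrite D0 (negPf ev0).
(* Truncation changes only coefficients of order above [k], so it does not disturb the congruence
   modulo ['X^(j.+1)] when [j <= k]. *)
have step_cong p q j : (j < k.+1)%N ->
    (forall D, D \in ev -> 'X %| p D) -> (forall D, D \in ev -> 'X %| q D) ->
    (forall D, D \in ev -> 'X^j %| p D - q D) -> forall D, D \in ev ->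
    'X^(j.+1) %| dem_step lam k p D - dem_step lam k q D.
  move=> jk Xp Xq pq D Dev; rewrite /dem_step -(raddfB (@take_poly K k.+1)) /=.
  set h := (h in take_poly _ h).
  rewrite -(subrK h (take_poly _ _)) dvdp_add //.
    by apply: dvdp_trans (dvdXn_take _ _); apply: dvdp_exp2l.
  have := dem_value_contract Dev Xp Xq pq; rewrite -dvdpNr.
  by congr (_ %| _); rewrite /h; ring.
have itcong j : (j <= k.+1)%N -> forall D, D \in ev ->
    'X^j %| it j.+1 D - it j D.
  elim: j => [|j IHj] jk D Dev; first by rewrite expr0 dvd1p.
  apply: (step_cong (it j.+1) (it j)) => // [A|A|]; [exact: itX|exact: itX|].
  by apply: IHj; apply: ltnW.
exists (it k.+1) => D Dev; split; [|exact: itX|exact: itS|].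
  exact: size_take_poly.
have := itcong k.+1 (leqnn _) D Dev; rewrite [it k.+2 D]/= /dem_step -/(it _).
set h := (h in take_poly _ h) => d1.
have := dvdp_sub (dvdXn_take k.+1 h) d1.
by congr (_ %| _); rewrite /h; ring.
Qed.

End Contraction.
End PolynomialModel.

(** * Pauli matrices *)

Local Open Scope complex_scope.

Section Adjoint.
Variable R : realType.

Lemma adjmxK p q : cancel (@adjmx R p q) (@adjmx R q p).
Proof. by move=> A; apply/matrixP=> i j; rewrite !mxE conjcK. Qed.

Lemma adjmxD p q (A B : 'M[R[i]]_(p, q)) : adjmx (A + B) = adjmx A + adjmx B.
Proof. by apply/matrixP=> i j; rewrite !mxE rmorphD. Qed.

Lemma adjmxN p q (A : 'M[R[i]]_(p, q)) : adjmx (- A) = - adjmx A.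
Proof. by apply/matrixP=> i j; rewrite !mxE rmorphN. Qed.

Lemma adjmxB p q (A B : 'M[R[i]]_(p, q)) : adjmx (A - B) = adjmx A - adjmx B.
Proof. by rewrite adjmxD adjmxN. Qed.

Lemma adjmxZ p q c (A : 'M[R[i]]_(p, q)) : adjmx (c *: A) = conjc c *: adjmx A.
Proof. by apply/matrixP=> i j; rewrite !mxE rmorphM. Qed.

Lemma adjmxM p q r (A : 'M[R[i]]_(p, q)) (B : 'M[R[i]]_(q, r)) :
  adjmx (A *m B) = adjmx B *m adjmx A.
Proof. by rewrite /adjmx map_mxM trmx_mul. Qed.

Lemma adjmx_sum p q (I : Type) (s : seq I) (F : I -> 'M[R[i]]_(p, q)) :
  adjmx (\sum_(i <- s) F i) = \sum_(i <- s) adjmx (F i).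
Proof.
elim: s => [|x s IHs]; last by rewrite !big_cons adjmxD IHs.
by rewrite !big_nil /adjmx map_mx0 trmx0.
Qed.

Lemma adjmx1 p : adjmx (1%:M : 'M[R[i]]_p) = 1%:M.
Proof. by rewrite /adjmx map_mx1 trmx1. Qed.

Lemma mxtrace_adj p (A : 'M[R[i]]_p) : \tr (adjmx A) = conjc (\tr A).
Proof.
rewrite /adjmx mxtrace_tr /mxtrace rmorph_sum.
by apply: eq_bigr => i _; rewrite mxE.
Qed.

Lemma adjmx_norm0 p (v : 'cV[R[i]]_p) : adjmx v *m v = 0 -> v = 0.
Proof.
move=> /matrixP/(_ 0 0); rewrite !mxE => v0.
have /eqP := v0; rewrite psumr_eq0 => [/allP all0|i _]; last first.
  by rewrite !mxE mulrC -sqr_normc exprn_ge0.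
apply/matrixP=> i j; rewrite !mxE ord1; apply/eqP.
have := all0 i (mem_index_enum _); rewrite !mxE mulrC -sqr_normc.
by rewrite expf_eq0 /= normr_eq0.
Qed.

End Adjoint.

Section PauliMatrices.
Variable R : realType.

Definition anticommute1 (p q : pauli1) : bool :=
  [&& p != PI, q != PI & p != q].

Lemma pauli1_mxC p q : pauli1_mx R p *m pauli1_mx R q =
  (-1) ^+ anticommute1 p q *: (pauli1_mx R q *m pauli1_mx R p).
Proof.
apply/matrixP=> a b; case: p q => [] [];
  rewrite ?mulmx1 ?mul1mx ?scale1r //= !mxE !big_ord_recl !big_ord0 !mxE;
  by case: a b => [[|[|//]] ?] [[|[|//]] ?]; rewrite /=; ring.
Qed.

Lemma adj_pauli1_mx p : adjmx (pauli1_mx R p) = pauli1_mx R p.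
Proof.
case: p; first exact: adjmx1.
- by apply/matrixP=> a b; rewrite !mxE conjc_nat eq_sym.
- apply/matrixP=> a b; rewrite !mxE !rmorphM /= conjc_nat rmorphXn rmorphN1.
  by case: a b => [[|[|//]] ?] [[|[|//]] ?]; simpc.
apply/matrixP=> a b; rewrite !mxE rmorphM /= conjc_nat rmorphXn rmorphN1 eq_sym.
by case: eqVneq => [->//|_]; rewrite !mul0r.
Qed.

Lemma pauli1_mx_sqr p : pauli1_mx R p *m pauli1_mx R p = 1%:M.
Proof.
apply/matrixP=> a b; case: p;
  rewrite ?mulmx1 //= !mxE ?big_ord_recl ?big_ord0 ?mxE;
  by case: a b => [[|[|//]] ?] [[|[|//]] ?]; rewrite /=; simpc.
Qed.

Variable n : nat.

Definition tensor_mx (f : 'I_n -> 'M[R[i]]_2) : 'M[R[i]]_(qdim n) :=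
  \matrix_(x, y) \prod_(j < n) f j (basis_string x j) (basis_string y j).

(** The mixed-product rule: distributing a product of sums over two indices gives a sum over bit
    strings, which [enum_rank] identifies with the basis. *)
Lemma tensor_mxM f g :
  tensor_mx f *m tensor_mx g = tensor_mx (fun j => f j *m g j).
Proof.
apply/matrixP=> x y; rewrite !mxE.
under [RHS]eq_bigr do rewrite mxE.
rewrite bigA_distr_bigA (reindex_onto enum_rank enum_val) => [|z _] /=;
  last by rewrite enum_valK.
apply: eq_big => [z|z _]; first by rewrite enum_rankK eqxx.
rewrite !mxE -big_split /=; apply: eq_bigr => j _.
by rewrite /basis_string !enum_rankK.
Qed.

Lemma tensor_mxZ (c : 'I_n -> R[i]) f :
  tensor_mx (fun j => c j *: f j) = (\prod_j c j) *: tensor_mx f.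
Proof.
apply/matrixP=> x y; rewrite !mxE -big_split /=.
by apply: eq_bigr => j _; rewrite mxE.
Qed.

Lemma tensor_mx1 : tensor_mx (fun=> 1%:M) = 1%:M.
Proof.
apply/matrixP=> x y; rewrite !mxE; have [<-|xy] := eqVneq x y.
  by rewrite big1 // => j _; rewrite mxE eqxx.
have [j jxy] : exists j, basis_string x j != basis_string y j.
  apply: contrapT => /forallNP xyE; case/eqP: xy; apply: enum_val_inj.
  by apply/ffunP=> j; apply/eqP/negPn/negP/xyE.
by rewrite (bigD1 j) //= mxE (negPf jxy) mul0r.
Qed.

Lemma adj_tensor_mx f : adjmx (tensor_mx f) = tensor_mx (fun j => adjmx (f j)).
Proof.
apply/matrixP=> x y; rewrite !mxE rmorph_prod.
by apply: eq_bigr => j _; rewrite !mxE.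
Qed.

Lemma pauli_mxE (P : pauli n) :
  pauli_mx R P = (-1) ^+ P.1 *: tensor_mx (fun j => pauli1_mx R (P.2 j)).
Proof. by []. Qed.

Definition anticommute (P Q : pauli n) : bool :=
  odd (\sum_j anticommute1 (P.2 j) (Q.2 j)).

(** Each site with anticommuting factors contributes a sign, and only the parity of their number
    survives. Thus two Paulis either commute or anticommute. *)
Lemma pauli_mxC (P Q : pauli n) : pauli_mx R P *m pauli_mx R Q =
  (-1) ^+ anticommute P Q *: (pauli_mx R Q *m pauli_mx R P).
Proof.
rewrite !pauli_mxE -!scalemxAl -!scalemxAr !scalerA !tensor_mxM.
rewrite (_ : tensor_mx _ = tensor_mx (fun j =>
    (-1) ^+ anticommute1 (P.2 j) (Q.2 j) *:
    (pauli1_mx R (Q.2 j) *m pauli1_mx R (P.2 j)))); last first.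
  apply/matrixP=> x y; rewrite !mxE; apply: eq_bigr => j _.
  by rewrite pauli1_mxC.
rewrite tensor_mxZ scalerA; congr (_ *: _).
rewrite prodrXr signr_odd; ring.
Qed.

Lemma adj_pauli_mx (P : pauli n) : adjmx (pauli_mx R P) = pauli_mx R P.
Proof.
rewrite !pauli_mxE adjmxZ rmorphXn rmorphN1 adj_tensor_mx; congr (_ *: _).
apply/matrixP=> x y; rewrite !mxE; apply: eq_bigr => j _.
by rewrite adj_pauli1_mx.
Qed.

Lemma pauli_mx_sqr (P : pauli n) : pauli_mx R P *m pauli_mx R P = 1%:M.
Proof.
rewrite !pauli_mxE -!scalemxAl -!scalemxAr !scalerA tensor_mxM.
rewrite -expr2 sqrr_sign scale1r -tensor_mx1.
apply/matrixP=> x y; rewrite !mxE; apply: eq_bigr => j _.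
by rewrite pauli1_mx_sqr.
Qed.

End PauliMatrices.

(** * Pauli words *)

Lemma mulmx_big_eigen (K : comPzRingType) N (I : Type) (s : seq I) (P : pred I)
    (f : I -> 'M[K]_N) (c : I -> K) m (v : 'M[K]_(N, m)) :
  (forall i, P i -> f i *m v = c i *: v) ->
  (\prod_(i <- s | P i) f i) *m v = (\prod_(i <- s | P i) c i) *: v.
Proof.
move=> fv; elim/big_rec2: _ => [|i x A Pi Av]; first by rewrite mul1mx scale1r.
by rewrite -mulmxA Av -scalemxAr fv // scalerA mulrC.
Qed.

Lemma big_eigen_mulmx (K : comPzRingType) N (I : Type) (s : seq I) (P : pred I)
    (f : I -> 'M[K]_N) (c : I -> K) m (v : 'M[K]_(m, N)) :
  (forall i, P i -> v *m f i = c i *: v) ->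
  v *m (\prod_(i <- s | P i) f i) = (\prod_(i <- s | P i) c i) *: v.
Proof.
move=> fv; elim/big_rec2: _ => [|i x A Pi Av]; first by rewrite mulmx1 scale1r.
by rewrite mulmxA fv // -scalemxAl Av scalerA.
Qed.

Section Words.
Variables (R : realType) (n : nat) (DD : {set pauli n}).
Implicit Types (P Q : pauli n) (a b : seq (pauli n)) (S : {set pauli n}).

(** [dem_event] is defined by failure to commute; since Paulis otherwise anticommute, membership
    becomes an explicit sign. *)
Lemma dem_event_mxC P Q : P \in DD -> pauli_mx R P *m pauli_mx R Q =
  (-1) ^+ (P \in dem_event R DD Q) *: (pauli_mx R Q *m pauli_mx R P).
Proof.
move=> PDD; rewrite inE PDD /=; have := pauli_mxC R P Q.
case: (boolP (comm_mxb _ _)) => [/comm_mxP -> _|]; first by rewrite scale1r.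
case: (anticommute P Q) => // ncomm PQ; case/negP: ncomm; apply/comm_mxP.
by rewrite /comm_mx PQ scale1r.
Qed.

Definition word_mx a : 'M[R[i]]_(qdim n) :=
  foldr (fun P A => pauli_mx R P *m A) 1%:M a.

Definition word_event a : {set pauli n} :=
  \big[@symdiff (pauli n)/finset.set0]_(P <- a) dem_event R DD P.

Lemma word_mx_cat a b : word_mx (a ++ b) = word_mx a *m word_mx b.
Proof. by elim: a => [|P a IHa] /=; rewrite ?mul1mx // IHa mulmxA. Qed.

Lemma word_mx1 P : word_mx [:: P] = pauli_mx R P.
Proof. exact: mulmx1. Qed.

Lemma adj_word_mx a : adjmx (word_mx a) = word_mx (rev a).
Proof.
elim: a => [|P a IHa]; first exact: adjmx1.
by rewrite rev_cons -cats1 word_mx_cat word_mx1 /= adjmxM IHa adj_pauli_mx.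
Qed.

Lemma word_event_sub a : word_event a \subset DD.
Proof.
rewrite /word_event; elim/big_ind: _ => [|A B|P _]; first exact: finset.sub0set.
  exact: symdiff_sub.
by apply/fintype.subsetP=> Q; rewrite inE => /andP[].
Qed.

Lemma word_event_rev a : word_event (rev a) = word_event a.
Proof. by apply: perm_big; rewrite perm_rev. Qed.

Lemma word_event_mxC P a : P \in DD -> pauli_mx R P *m word_mx a =
  (-1) ^+ (P \in word_event a) *: (word_mx a *m pauli_mx R P).
Proof.
move=> PDD; rewrite /word_event; elim: a => [|Q a IHa].
  by rewrite big_nil inE mulmx1 mul1mx scale1r.
rewrite big_cons /= mulmxA dem_event_mxC // -scalemxAl -mulmxA IHa.
by rewrite -scalemxAr scalerA -signr_addb -in_symdiff mulmxA.
Qed.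

Variable psi : 'cV[R[i]]_(qdim n).
Hypothesis psi1 : adjmx psi *m psi = 1%:M.
Hypothesis DDpsi : forall P, P \in DD -> detector psi P.

Let rho := psi *m adjmx psi.

(** A detector is given only by its expectation value 1. As [P] is Hermitian with square 1, the
    squared norm of [P psi - psi] is 1 - 1 - 1 + 1 = 0. *)
Lemma detector_fix P : P \in DD -> pauli_mx R P *m psi = psi.
Proof.
move=> /DDpsi dP; apply/subr0_eq/adjmx_norm0.
rewrite adjmxB adjmxM adj_pauli_mx mulmxBl !mulmxBr !mulmxA.
rewrite -[_ *m pauli_mx R P *m pauli_mx R P]mulmxA pauli_mx_sqr mulmx1.
by rewrite dP psi1 !subrr.
Qed.

Lemma detector_mul_state P : P \in DD -> pauli_mx R P *m rho = rho.
Proof. by move=> PDD; rewrite mulmxA detector_fix. Qed.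

Lemma state_mul_detector P : P \in DD -> rho *m pauli_mx R P = rho.
Proof.
move=> PDD; rewrite -mulmxA -[pauli_mx R P]adj_pauli_mx -adjmxM.
by rewrite detector_fix.
Qed.

Lemma adj_state : adjmx rho = rho.
Proof. by rewrite adjmxM adjmxK. Qed.

Lemma adj_word_state a b : adjmx (word_mx a *m rho *m word_mx b) =
  word_mx (rev b) *m rho *m word_mx (rev a).
Proof.
by rewrite adjmxM (adjmxM (word_mx a)) adj_state !adj_word_mx mulmxA.
Qed.

Lemma trace_state : \tr rho = 1.
Proof. by rewrite mxtrace_mulC psi1 mxtrace1. Qed.

Lemma half_sign (x : bool) :
  (2^-1 * (1 - (-1) ^+ x) = x%:R :> R[i]) *
  (2^-1 * (1 + (-1) ^+ x) = (~~ x)%:R :> R[i]).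
Proof.
split; case: x; rewrite ?expr1 ?expr0 ?opprK ?subrr ?mulr0 //.
  by rewrite -[1 + 1]/(2%:R) mulVf // pnatr_eq0.
by rewrite -[1 + 1]/(2%:R) mulVf // pnatr_eq0.
Qed.

Lemma prod_syndrome S (A : {set pauli n}) : S \subset DD -> A \subset DD ->
  (\prod_(P in S) ((P \in A)%:R : R[i])) *
    (\prod_(P in (DD :\: S)%SET) (P \notin A)%:R) = (S == A)%:R.
Proof.
move=> /fintype.subsetP SDD /fintype.subsetP ADD.
have [<-|SA] := eqVneq S A.
  rewrite !big1 ?mulr1 // => P; first by rewrite inE => /andP[->].
  by move=> ->.
have [P PSA] : exists P, (P \in S) != (P \in A).
  apply: contrapT => /forallNP E; case/eqP: SA; apply/setP=> P.
  exact/eqP/negPn/negP/E.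
have [PS|PS] := boolP (P \in S).
  move: PSA; rewrite PS (bigD1 P) //=.
  by case: (P \in A) => // _; rewrite !mul0r.
move: PSA; rewrite (negPf PS) mulrC.
case PA: (P \in A) => // _; rewrite (bigD1 P) /=.
  by rewrite PA !mul0r.
by rewrite inE PS ADD.
Qed.

(** Moving a detector through the word costs the sign of [word_event_mxC], after which [rho] absorbs
    it. So [word_mx a *m rho] is a joint eigenvector, and each factor of the projector acts as 0 or
    1. *)
Lemma history_proj_word S a : S \subset DD ->
  history_proj R DD S *m (word_mx a *m rho) =
  (S == word_event a)%:R *: (word_mx a *m rho).
Proof.
move=> SDD; rewrite -(prod_syndrome SDD (word_event_sub a)) /history_proj.
have Pa P : P \in DD -> pauli_mx R P *m (word_mx a *m rho) =
    (-1) ^+ (P \in word_event a) *: (word_mx a *m rho).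
  move=> PDD; rewrite mulmxA word_event_mxC // -scalemxAl -mulmxA.
  by rewrite detector_mul_state.
set v := word_mx a *m rho in Pa *.
have vS : (\prod_(P in S) (2^-1 *: (1%:M - pauli_mx R P))) *m v =
    (\prod_(P in S) (P \in word_event a)%:R) *: v.
  apply: mulmx_big_eigen => P /(fintype.subsetP SDD) PDD.
  rewrite -scalemxAl mulmxBl mul1mx Pa //.
  by rewrite -[X in X - _]scale1r -scalerBl scalerA half_sign.
have vD : (\prod_(P in (DD :\: S)%SET) (2^-1 *: (1%:M + pauli_mx R P))) *m v =
    (\prod_(P in (DD :\: S)%SET) (P \notin word_event a)%:R) *: v.
  apply: mulmx_big_eigen => P; rewrite inE => /andP[_ PDD].
  rewrite -scalemxAl mulmxDl mul1mx Pa //.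
  by rewrite -[X in X + _]scale1r -scalerDl scalerA half_sign.
by rewrite -mulmxE -mulmxA vD -scalemxAr vS scalerA mulrC.
Qed.

Lemma word_history_proj S b : S \subset DD ->
  (rho *m word_mx b) *m history_proj R DD S =
  (S == word_event b)%:R *: (rho *m word_mx b).
Proof.
move=> SDD; rewrite -(prod_syndrome SDD (word_event_sub b)) /history_proj.
have Pb P : P \in DD -> (rho *m word_mx b) *m pauli_mx R P =
    (-1) ^+ (P \in word_event b) *: (rho *m word_mx b).
  move=> PDD; rewrite -mulmxA -[in RHS](state_mul_detector PDD) -[in RHS]mulmxA.
  rewrite word_event_mxC // -[in RHS]scalemxAr scalerA -signr_addb addbb.
  by rewrite scale1r.
set v := rho *m word_mx b in Pb *.
have vS : v *m (\prod_(P in S) (2^-1 *: (1%:M - pauli_mx R P))) =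
    (\prod_(P in S) (P \in word_event b)%:R) *: v.
  apply: big_eigen_mulmx => P /(fintype.subsetP SDD) PDD.
  rewrite -scalemxAr mulmxBr mulmx1 Pb //.
  by rewrite -[X in X - _]scale1r -scalerBl scalerA half_sign.
have vD : v *m (\prod_(P in (DD :\: S)%SET) (2^-1 *: (1%:M + pauli_mx R P))) =
    (\prod_(P in (DD :\: S)%SET) (P \notin word_event b)%:R) *: v.
  apply: big_eigen_mulmx => P; rewrite inE => /andP[_ PDD].
  rewrite -scalemxAr mulmxDr mulmx1 Pb //.
  by rewrite -[X in X + _]scale1r -scalerDl scalerA half_sign.
by rewrite -mulmxE mulmxA vS -scalemxAl vD scalerA.
Qed.

Lemma trace_history_word S a b : S \subset DD ->
  \tr (history_proj R DD S *m (word_mx a *m rho *m word_mx b)) =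
  (S == word_event a)%:R * \tr (word_mx a *m rho *m word_mx b).
Proof.
by move=> SDD; rewrite mulmxA history_proj_word // -scalemxAl mxtraceZ.
Qed.

Lemma trace_history_wordr S a b : S \subset DD ->
  \tr (history_proj R DD S *m (word_mx a *m rho *m word_mx b)) =
  (S == word_event b)%:R * \tr (word_mx a *m rho *m word_mx b).
Proof.
move=> SDD; rewrite mxtrace_mulC -(mulmxA (word_mx a)) -(mulmxA (word_mx a)).
by rewrite word_history_proj // -scalemxAr mxtraceZ.
Qed.

(** * Operators reachable from the state with a bounded number of letters *)

Section Span.
Variable I : pred (pauli n).

Let E : {set {set pauli n}} := [set dem_event R DD P | P in I]%SET.

(** Level [j] stands for order [j] in the rates, each application of a generator adding at most two
    letters. Only the total length is bounded, so the letters may be split unevenly between the two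
    sides. *)
Inductive word_span (j : nat) : 'M[R[i]]_(qdim n) -> Prop :=
| WordSpan0 : word_span j 0
| WordSpanD A B : word_span j A -> word_span j B -> word_span j (A + B)
| WordSpanZ c A : word_span j A -> word_span j (c *: A)
| WordSpanGen a b : all I a -> all I b -> (size a + size b <= j.*2)%N ->
    word_span j (word_mx a *m rho *m word_mx b).

Lemma word_spanN j A : word_span j A -> word_span j (- A).
Proof. by rewrite -scaleN1r; apply: WordSpanZ. Qed.

Lemma word_span_sum j (J : Type) (s : seq J) (F : J -> 'M[R[i]]_(qdim n)) :
  (forall x, word_span j (F x)) -> word_span j (\sum_(x <- s) F x).
Proof.
by move=> FS; elim/big_ind: _ => //; [apply: WordSpan0 | apply: WordSpanD].
Qed.

Lemma word_span_mul i j a b A : word_span j A -> all I a -> all I b ->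
  (size a + size b <= i.*2)%N ->
  word_span (i + j) (word_mx a *m A *m word_mx b).
Proof.
move=> AS Ia Ib ab; elim: AS => [|B C _ IHB _ IHC|c B _ IHB|a' b' Ia' Ib' ab'].
- by rewrite mulmx0 mul0mx; apply: WordSpan0.
- by rewrite mulmxDr mulmxDl; apply: WordSpanD.
- by rewrite -scalemxAr -scalemxAl; apply: WordSpanZ.
rewrite (_ : _ *m _ = word_mx (a ++ a') *m rho *m word_mx (b' ++ b));
  last by rewrite !word_mx_cat !mulmxA.
apply: WordSpanGen.
- by rewrite all_cat Ia.
- by rewrite all_cat Ib'.
- by rewrite !size_cat doubleD; lia.
Qed.

Lemma word_event_upto j a : all I a -> (size a <= j)%N ->
  word_event a \in symdiffs_upto E j.
Proof.
move=> /allP Ia aj; rewrite /word_event -(big_map (dem_event R DD) xpredT id).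
apply: symdiffs_upto_seq; first by rewrite size_map.
by move=> D /mapP[P /Ia IP ->]; apply: imset_f.
Qed.

(* On a generator, the trace is nonzero only if [a] and [b] both produce the
   history [S], and the shorter of the two words has at most [j] letters. *)
Lemma trace_history_span j A S : word_span j A -> S \subset DD ->
  \tr (history_proj R DD S *m A) != 0 -> S \in symdiffs_upto E j.
Proof.
move=> AS SDD; elim: AS => [|B C _ IHB _ IHC|c B _ IHB|a b Ia Ib ab].
- by rewrite mulmx0 mxtrace0 eqxx.
- rewrite mulmxDr mxtraceD.
  have [->|/IHB//] := eqVneq (\tr (history_proj R DD S *m B)) 0.
  by rewrite add0r.
- by rewrite -scalemxAr mxtraceZ mulf_eq0 negb_or => /andP[_ /IHB].
have [aj|ja] := leqP (size a) j.
  rewrite trace_history_word // mulf_eq0 negb_or pnatr_eq0 eqb0 negbK.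
  by move=> /andP[/eqP-> _]; apply: word_event_upto.
rewrite trace_history_wordr // mulf_eq0 negb_or pnatr_eq0 eqb0 negbK.
by move=> /andP[/eqP-> _]; apply: word_event_upto => //; lia.
Qed.

(** Completeness of the projectors on the span: on a generator exactly one history, [word_event a],
    contributes, and it carries the full trace. *)
Lemma sum_trace_history_span j A : word_span j A ->
  \sum_(S : {set pauli n} | S \subset DD) \tr (history_proj R DD S *m A) =
  \tr A.
Proof.
elim=> [|B C _ IHB _ IHC|c B _ IHB|a b _ _ _].
- by rewrite mxtrace0 big1 // => S _; rewrite mulmx0 mxtrace0.
- rewrite mxtraceD -IHB -IHC -big_split; apply: eq_bigr => S _.
  by rewrite mulmxDr mxtraceD.
- rewrite mxtraceZ -IHB mulr_sumr; apply: eq_bigr => S _.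
  by rewrite -scalemxAr mxtraceZ.
rewrite (bigD1 (word_event a)) ?word_event_sub //=.
rewrite trace_history_word ?word_event_sub //.
rewrite eqxx mul1r big1 ?addr0 // => S /andP[SDD /negPf SE].
by rewrite trace_history_word // SE mul0r.
Qed.

(** Taking adjoints swaps and reverses the two words without changing their events, so the formula
    for the right word becomes that for the left word. This makes the probabilities of Hermitian
    operators real. *)
Lemma conj_trace_history_span j A S : word_span j A -> S \subset DD ->
  conjc (\tr (history_proj R DD S *m A)) = \tr (history_proj R DD S *m adjmx A).
Proof.
move=> AS SDD; elim: AS => [|B C _ IHB _ IHC|c B _ IHB|a b _ _ _].
- by rewrite /adjmx map_mx0 trmx0 mulmx0 mxtrace0 conjc0.
- by rewrite adjmxD !mulmxDr !mxtraceD rmorphD /= IHB IHC.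
- by rewrite adjmxZ -!scalemxAr !mxtraceZ rmorphM /= IHB.
rewrite trace_history_wordr // rmorphM /= conjc_nat -mxtrace_adj.
by rewrite adj_word_state trace_history_word // word_event_rev.
Qed.

End Span.
End Words.

(** * Error generators *)

Section LinearIdentities.
Variables (K : comPzRingType) (V : lmodType K).
Implicit Types (c h u : K) (x y : V).

(** The shape of a [CGen] map, with [h] standing for 1/2. *)
Lemma linear_combB c h x1 x2 x3 y1 y2 y3 :
  (c *: x1 + y1) + (c *: x2 + y2) - h *: (c *: x3 + y3) =
  c *: (x1 + x2 - h *: x3) + (y1 + y2 - h *: y3).
Proof.
rewrite (addrACA (c *: x1)) -scalerDr (scalerDr h) opprD scalerA mulrC -scalerA.
by rewrite addrACA -scalerBr.
Qed.

(** The shape of an [AGen] map, with [u] standing for the imaginary unit. *)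
Lemma linear_combZ u c h x1 x2 x3 y1 y2 y3 :
  u *: ((c *: x1 + y1) - (c *: x2 + y2) + h *: (c *: x3 + y3)) =
  c *: (u *: (x1 - x2 + h *: x3)) + u *: (y1 - y2 + h *: y3).
Proof.
rewrite opprD (addrACA (c *: x1)) -scalerBr (scalerDr h) scalerA [h * c]mulrC.
rewrite -scalerA.
by rewrite addrACA -scalerDr (scalerDr u) !scalerA [u * c]mulrC.
Qed.

Lemma scale_oppB u h x1 x2 x3 :
  - u *: (x2 - x1 + h *: - x3) = u *: (x1 - x2 + h *: x3).
Proof.
rewrite scaleNr -scalerN; congr (_ *: _).
by rewrite scalerN opprD opprB opprK.
Qed.

End LinearIdentities.

Lemma half_double_sub (K : numFieldType) (a b : K) :
  a + b - 2^-1 * (a + b + (a + b)) = 0.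
Proof. by field. Qed.

Lemma half_double_add (K : numFieldType) (a b : K) :
  a - b + 2^-1 * (b - a + (b - a)) = 0.
Proof. by field. Qed.

Section Generators.
Variables (R : realType) (n : nat).
Implicit Types (P Q : pauli n) (A B : 'M[R[i]]_(qdim n)) (e : elem_label n).
Implicit Types g : error_gen R n.

Lemma commut_is_linear N (A : 'M[R[i]]_N) : linear (commut A).
Proof.
move=> c B C; rewrite /commut mulmxDr mulmxDl -scalemxAr -scalemxAl scalerBr.
by rewrite opprD addrACA.
Qed.

Lemma acommut_is_linear N (A : 'M[R[i]]_N) : linear (acommut A).
Proof.
move=> c B C; rewrite /acommut mulmxDr mulmxDl -scalemxAr -scalemxAl scalerDr.
by rewrite addrACA.
Qed.

Lemma elem_map_is_linear e : linear (@elem_map R n e).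
Proof.
have mulD (A B X Y : 'M[R[i]]_(qdim n)) c : A *m (c *: X + Y) *m B =
    c *: (A *m X *m B) + A *m Y *m B.
  by rewrite mulmxDr mulmxDl -scalemxAr -scalemxAl.
move=> c X Y; case: e => [P|P|P Q|P Q] /=.
- by rewrite commut_is_linear scalerDr !scalerA mulrC.
- by rewrite mulD scalerBr opprD addrACA.
- by rewrite !mulD acommut_is_linear linear_combB.
by rewrite !mulD acommut_is_linear linear_combZ.
Qed.

Lemma gen_map_is_linear g : linear (gen_map g).
Proof.
move=> c A B; rewrite /gen_map scaler_sumr -big_split; apply: eq_bigr => e _.
by rewrite elem_map_is_linear scalerDr !scalerA [_%:C * c]mulrC.
Qed.

HB.instance Definition _ g := GRing.isLinear.Build R[i] _ _ _ (gen_map g)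
  (gen_map_is_linear g).

(** By cyclicity every term becomes the trace of [A] times a product of index Paulis; the
    (anti)commutator term of [CGen] and [AGen] is normalised to cancel the sandwich terms. *)
Lemma trace_elem_map e A : \tr (elem_map e A) = 0.
Proof.
have trB (B C : 'M[R[i]]_(qdim n)) : \tr (B - C) = \tr B - \tr C.
  exact: raddfB.
have tr3 B C : \tr (B *m A *m C) = \tr (A *m (C *m B)).
  by rewrite -mulmxA mxtrace_mulC mulmxA.
have tr2 B : \tr (B *m A) = \tr (A *m B) by exact: mxtrace_mulC.
case: e => [P|P|P Q|P Q]; rewrite /= /commut /acommut.
- by rewrite mxtraceZ trB tr2 subrr mulr0.
- by rewrite trB tr3 pauli_mx_sqr mulmx1 subrr.
- rewrite trB mxtraceZ !mxtraceD tr2 !tr3 mulmxDr !mxtraceD.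
  by rewrite [X in _ - 2^-1 * (X + X)]addrC half_double_sub.
rewrite mxtraceZ mxtraceD trB mxtraceZ mxtraceD tr2 !tr3 mulmxBr trB.
by rewrite half_double_add mulr0.
Qed.

Lemma trace_gen_map g A : \tr (gen_map g A) = 0.
Proof.
rewrite /gen_map linear_sum big1 // => e _.
by rewrite linearZ /= trace_elem_map mulr0.
Qed.

Lemma adj_commut N (A B : 'M[R[i]]_N) :
  adjmx (commut A B) = - commut (adjmx A) (adjmx B).
Proof. by rewrite /commut adjmxB !adjmxM opprB. Qed.

Lemma adj_acommut N (A B : 'M[R[i]]_N) :
  adjmx (acommut A B) = acommut (adjmx A) (adjmx B).
Proof. by rewrite /acommut adjmxD !adjmxM addrC. Qed.

Lemma acommutN N (A B : 'M[R[i]]_N) : acommut (- A) B = - acommut A B.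
Proof. by rewrite /acommut mulNmx mulmxN opprD. Qed.

Lemma adj_elem_map e A : adjmx (elem_map e A) = elem_map e (adjmx A).
Proof.
have conj_i : ('i : R[i])^* = - 'i.
  by apply/eqP; rewrite eq_complex /= oppr0 !eqxx.
have conjN_i : (- 'i : R[i])^* = 'i by rewrite -[in LHS](conj_i) conjcK.
have conj_half : (2^-1 : R[i])^* = 2^-1 by rewrite conjc_inv conjc_nat.
case: e => [P|P|P Q|P Q]; rewrite /=.
- rewrite /commut adjmxZ adjmxB !adjmxM !adj_pauli_mx conjN_i.
  by rewrite scaleNr -scalerN opprB.
- by rewrite adjmxB !adjmxM !adj_pauli_mx mulmxA.
- rewrite adjmxB adjmxD adjmxZ conj_half.
  rewrite !adj_acommut !adjmxM !adj_pauli_mx !mulmxA.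
  by rewrite [pauli_mx R Q *m _ *m _ + _]addrC.
rewrite adjmxZ conj_i adjmxD adjmxB adjmxZ conj_half.
rewrite adj_acommut adj_commut !adjmxM !adj_pauli_mx !mulmxA.
by rewrite acommutN scale_oppB.
Qed.

Lemma adj_gen_map g A : adjmx (gen_map g A) = gen_map g (adjmx A).
Proof.
rewrite /gen_map adjmx_sum; apply: eq_bigr => e _.
by rewrite adjmxZ adj_elem_map conjc_real.
Qed.

Variables (psi : 'cV[R[i]]_(qdim n)) (I : pred (pauli n)).

(** Each term of an elementary generator surrounds [A] by at most two index Paulis, which is the
    allowance of one level. *)
Lemma word_span_elem_map j e A : {subset indices e <= I} ->
  word_span psi I j A -> word_span psi I j.+1 (elem_map e A).
Proof.
move=> eI AS.
have wS (a b : seq (pauli n)) : all I a -> all I b ->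
    (size a + size b <= 2)%N ->
    word_span psi I j.+1 (word_mx R a *m A *m word_mx R b).
  by move=> Ia Ib ab; rewrite -add1n; apply: word_span_mul.
have w0 P Q : P \in I -> Q \in I ->
    word_span psi I j.+1 (pauli_mx R P *m A *m pauli_mx R Q).
  by move=> PI QI; rewrite -!word_mx1; apply: wS; rewrite /= ?andbT.
have wl P Q : P \in I -> Q \in I ->
    word_span psi I j.+1 (pauli_mx R P *m pauli_mx R Q *m A).
  move=> PI QI; rewrite -!word_mx1 -word_mx_cat -[_ *m A]mulmx1.
  by apply: (wS _ [::]); rewrite //= ?andbT; apply/andP.
have wr P Q : P \in I -> Q \in I ->
    word_span psi I j.+1 (A *m (pauli_mx R P *m pauli_mx R Q)).
  move=> PI QI; rewrite -!word_mx1 -word_mx_cat -[A]mul1mx.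
  by apply: (wS [::]); rewrite //= ?andbT; apply/andP.
have wA : word_span psi I j.+1 A.
  by rewrite -[A]mulmx1 -[A]mul1mx; apply: (wS [::] [::]).
case: e eI => [P|P|P Q|P Q] eI /=.
- have PI : P \in I by apply: eI; rewrite inE.
  apply/WordSpanZ/WordSpanD; last apply: word_spanN.
    by rewrite -[_ *m A]mulmx1 -word_mx1; apply: (wS _ [::]); rewrite /= ?andbT.
  by rewrite -[A]mul1mx -word_mx1; apply: (wS [::]); rewrite /= ?andbT.
- have PI : P \in I by apply: eI; rewrite inE.
  by apply: WordSpanD; [apply: w0 | apply: word_spanN].
- have PI : P \in I by apply: eI; rewrite !inE eqxx.
  have QI : Q \in I by apply: eI; rewrite !inE eqxx orbT.
  apply: WordSpanD; first by apply: WordSpanD; apply: w0.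
  apply/word_spanN/WordSpanZ; rewrite /acommut mulmxDl mulmxDr.
  by apply: WordSpanD; apply: WordSpanD; by [apply: wl | apply: wr].
have PI : P \in I by apply: eI; rewrite !inE eqxx.
have QI : Q \in I by apply: eI; rewrite !inE eqxx orbT.
apply: WordSpanZ; apply: WordSpanD.
  by apply: WordSpanD; [|apply: word_spanN]; apply: w0.
apply: WordSpanZ; rewrite /acommut /commut mulmxBl mulmxBr.
by apply: WordSpanD; apply: WordSpanD; try apply: word_spanN;
  by [apply: wl | apply: wr].
Qed.

Definition gen_within g : Prop :=
  forall e : elem_gen n, g e != 0 -> {subset indices (val e) <= I}.

Lemma word_span_gen_map j g A : gen_within g ->
  word_span psi I j A -> word_span psi I j.+1 (gen_map g A).
Proof.
move=> gI AS; apply: word_span_sum => e.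
have [->|/gI eI] := eqVneq (g e) 0; first by rewrite scale0r; apply: WordSpan0.
exact/WordSpanZ/word_span_elem_map.
Qed.

(** Matrix polynomials in [eps] whose coefficient of order [j] lies in level [j] of the span. *)
Inductive word_poly : (R -> 'M[R[i]]_(qdim n)) -> Prop :=
| WordPoly0 : word_poly (fun=> 0)
| WordPolyD W V : word_poly W -> word_poly V ->
    word_poly (fun eps => W eps + V eps)
| WordPolyX j A : word_span psi I j A ->
    word_poly (fun eps => eps%:C ^+ j *: A).

(** The generator raises the level by one while the factor [eps] raises the power by one, so the two
    stay in step. *)
Lemma word_poly_gen g W : gen_within g -> word_poly W ->
  word_poly (fun eps => eps%:C *: gen_map g (W eps)).
Proof.
move=> gI; elim=> [|V V' _ IHV _ IHV'|j A AS].
- rewrite (_ : (fun=> _) = fun=> 0); first exact: WordPoly0.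
  by apply: funext => eps; rewrite linear0 scaler0.
- rewrite (_ : (fun=> _) = fun eps => eps%:C *: gen_map g (V eps) +
    eps%:C *: gen_map g (V' eps)); first exact: (WordPolyD IHV IHV').
  by apply: funext => eps; rewrite linearD scalerDr.
rewrite (_ : (fun=> _) = fun eps => eps%:C ^+ j.+1 *: gen_map g A).
  exact/WordPolyX/word_span_gen_map.
by apply: funext => eps; rewrite linearZ scalerA exprS.
Qed.

Lemma word_polyZ c W : word_poly W -> word_poly (fun eps => c *: W eps).
Proof.
elim=> [|V V' _ IHV _ IHV'|j A AS].
- rewrite (_ : (fun=> _) = fun=> 0); first exact: WordPoly0.
  by apply: funext => eps; rewrite scaler0.
- rewrite (_ : (fun=> _) = fun eps => c *: V eps + c *: V' eps).
    exact: (WordPolyD IHV IHV').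
  by apply: funext => eps; rewrite scalerDr.
rewrite (_ : (fun=> _) = fun eps => eps%:C ^+ j *: (c *: A)).
  exact/WordPolyX/WordSpanZ.
by apply: funext => eps; rewrite !scalerA mulrC.
Qed.

Lemma word_poly_sum N (W : nat -> R -> 'M[R[i]]_(qdim n)) :
  (forall j, word_poly (W j)) -> word_poly (fun eps => \sum_(j < N) W j eps).
Proof.
move=> WP; elim: N => [|N IHN].
  rewrite (_ : (fun=> _) = fun=> 0); first exact: WordPoly0.
  by apply: funext => eps; rewrite big_ord0.
rewrite (_ : (fun=> _) = fun eps => \sum_(j < N) W j eps + W N eps).
  exact: (WordPolyD IHN (WP N)).
by apply: funext => eps; rewrite big_ord_recr.
Qed.

End Generators.

(** * Norm estimates for the circuit channel *)

Local Open Scope classical_set_scope.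
Local Open Scope complex_scope.

Section MatrixNorm.
Variable R : realType.
Implicit Types x y : R[i].
Local Notation normc := Normc.normc.

Lemma normc_norm x : `|x| = (normc x)%:C.
Proof. by []. Qed.

Lemma normc_ge0 x : 0 <= normc x.
Proof. by case: x => a b; exact: sqrtr_ge0. Qed.

Lemma normcD x y : normc (x + y) <= normc x + normc y.
Proof. by have := ler_normD x y; rewrite !normc_norm -rmorphD lecR. Qed.

Lemma normcN x : normc (- x) = normc x.
Proof. by case: x => a b; rewrite /normc /= !sqrrN. Qed.

Lemma normc_real (r : R) : normc r%:C = `|r|.
Proof. by rewrite /normc /= expr0n addr0 sqrtr_sqr. Qed.

Lemma normc_Re x : `|complex.Re x| <= normc x.
Proof. by have := normc_ge_Re x; rewrite normc_norm lecR. Qed.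

Lemma normc_Im x : `|complex.Im x| <= normc x.
Proof.
case: x => a b /=; rewrite -[`|b|]sqrtr_sqr ler_sqrt ?addr_ge0 ?sqr_ge0 //.
by rewrite lerDr sqr_ge0.
Qed.

Variables p q : nat.
Implicit Types A B : 'M[R[i]]_(p, q).

Definition mxnorm (A : 'M[R[i]]_(p, q)) : R := \sum_a \sum_b normc (A a b).

Lemma mxnorm_ge0 A : 0 <= mxnorm A.
Proof. by apply: sumr_ge0 => a _; apply: sumr_ge0 => b _; apply: normc_ge0. Qed.

Lemma normc_le_mxnorm A a b : normc (A a b) <= mxnorm A.
Proof.
rewrite /mxnorm (bigD1 a) //= (bigD1 b) //= -addrA lerDl addr_ge0 //.
  by apply: sumr_ge0 => c _; apply: normc_ge0.
by apply: sumr_ge0 => c _; apply: sumr_ge0 => d _; apply: normc_ge0.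
Qed.

Lemma mxnormD A B : mxnorm (A + B) <= mxnorm A + mxnorm B.
Proof.
rewrite /mxnorm -big_split ler_sum // => a _.
rewrite -big_split ler_sum // => b _.
by rewrite mxE normcD.
Qed.

Lemma mxnorm0 : mxnorm 0 = 0.
Proof.
rewrite /mxnorm big1 // => a _; rewrite big1 // => b _.
by rewrite mxE Normc.normc0.
Qed.

Lemma mxnormZ c A : mxnorm (c *: A) = normc c * mxnorm A.
Proof.
rewrite /mxnorm mulr_sumr; apply: eq_bigr => a _.
by rewrite mulr_sumr; apply: eq_bigr => b _; rewrite mxE Normc.normcM.
Qed.

Lemma mxnorm_sum (J : Type) (s : seq J) (P : pred J)
    (F : J -> 'M[R[i]]_(p, q)) :
  mxnorm (\sum_(j <- s | P j) F j) <= \sum_(j <- s | P j) mxnorm (F j).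
Proof.
elim/big_rec2: _ => [|j x A _ Ax]; first by rewrite mxnorm0.
by rewrite (le_trans (mxnormD _ _)) // lerD2l.
Qed.

End MatrixNorm.

(** Expanding in matrix units bounds the map by the sum of the norms of their images. *)
Lemma linear_mxnorm_bound (R : realType) p q r s
    (f : {linear 'M[R[i]]_(p, q) -> 'M[R[i]]_(r, s)}) :
  exists2 C : R, 0 <= C & forall A, mxnorm (f A) <= C * mxnorm A.
Proof.
exists (\sum_a \sum_b mxnorm (f (delta_mx a b))) => [|A].
  by apply: sumr_ge0 => a _; apply: sumr_ge0 => b _; apply: mxnorm_ge0.
rewrite {1}(matrix_sum_delta A) linear_sum (le_trans (mxnorm_sum _ _ _)) //.
rewrite mulr_suml ler_sum // => a _; rewrite linear_sum.
rewrite (le_trans (mxnorm_sum _ _ _)) // mulr_suml ler_sum // => b _.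
rewrite linearZ mxnormZ mulrC ler_wpM2l ?mxnorm_ge0 //.
exact: normc_le_mxnorm.
Qed.

(** * Convergence of the exponential series *)

Section Exponential.
Variables (R : realType) (N : nat).
Local Notation normc := Normc.normc.

Definition exp_partial (Phi : 'M[R[i]]_N -> 'M[R[i]]_N) (A : 'M[R[i]]_N)
    (M : nat) : 'M[R[i]]_N :=
  \sum_(j < M) (j`!%:R^-1 : R[i]) *: iter j Phi A.

Variables (Phi : 'M[R[i]]_N -> 'M[R[i]]_N) (c : R).
Hypothesis c_ge0 : 0 <= c.
Hypothesis Phi_bound : forall A, mxnorm (Phi A) <= c * mxnorm A.

Lemma mxnorm_iter j A : mxnorm (iter j Phi A) <= c ^+ j * mxnorm A.
Proof.
elim: j => [|j IHj] /=; first by rewrite mul1r.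
by rewrite (le_trans (Phi_bound _)) // exprS -mulrA ler_wpM2l.
Qed.

Lemma mxnorm_exp_term j A :
  mxnorm ((j`!%:R^-1 : R[i]) *: iter j Phi A) <= exp_coeff c j * mxnorm A.
Proof.
have -> : (j`!%:R^-1 : R[i]) = (j`!%:R^-1 : R)%:C by rewrite fmorphV rmorph_nat.
rewrite mxnormZ normc_real ger0_norm ?invr_ge0 ?ler0n // /exp_coeff /=.
by rewrite mulrAC mulrC ler_wpM2r ?invr_ge0 ?ler0n // mxnorm_iter.
Qed.

Lemma series_exp_coeff_le M : \sum_(j < M) exp_coeff c j <= expR c.
Proof.
rewrite -(big_mkord xpredT (exp_coeff c)).
apply: (@nondecreasing_cvgn_le _ (series (exp_coeff c))); last first.
  exact: is_cvg_series_exp_coeff.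
by apply: nondecreasing_series => j _ _; apply: exp_coeff_ge0.
Qed.

Lemma exp_partial_bound M A : mxnorm (exp_partial Phi A M) <= expR c * mxnorm A.
Proof.
rewrite (le_trans (mxnorm_sum _ _ _)) //.
rewrite (le_trans _ (ler_wpM2r (mxnorm_ge0 _) (series_exp_coeff_le M))) //.
by rewrite mulr_suml ler_sum // => j _; apply: mxnorm_exp_term.
Qed.

(* R[i] carries no completeness instance, so the limit is built from the
   absolutely convergent series of real and imaginary parts. *)
Lemma exp_partial_cvg A : cvgn (exp_partial Phi A : nat -> 'M[R[i]^o]_N).
Proof.
pose u a b j := (((j`!%:R^-1 : R[i]) *: iter j Phi A) a b).
have ucvg (h : R[i] -> R) a b : (forall x, `|h x| <= normc x) ->
    cvgn (series (fun j => h (u a b j))).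
  move=> hn; apply: normed_cvg.
  apply: (@series_le_cvg _ _ (fun j => exp_coeff c j * mxnorm A)).
  - by move=> j; apply: normr_ge0.
  - by move=> j; rewrite mulr_ge0 ?mxnorm_ge0 ?exp_coeff_ge0.
  - move=> j /=; rewrite (le_trans (hn _)) //.
    rewrite (le_trans (normc_le_mxnorm _ _ _)) //.
    exact: mxnorm_exp_term.
  rewrite (_ : (fun j => _) = mxnorm A *: exp_coeff c); last first.
    by apply: funext => j; rewrite mulrC.
  exact/is_cvg_seriesZ/is_cvg_series_exp_coeff.
have cRe a b := ucvg (@complex.Re R) a b (@normc_Re R).
have cIm a b := ucvg (@complex.Im R) a b (@normc_Im R).
pose L : 'M[R[i]^o]_N := \matrix_(a, b)
  (limn (series (fun j => complex.Re (u a b j))) +i*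
   limn (series (fun j => complex.Im (u a b j)))).
apply/cvg_ex; exists L; apply/cvg_ballP => e e0.
(* The radius [e] lives in [R[i]]; being positive it is real, and half of it goes to each of the
   real and imaginary parts. *)
have [e' e'0 ee'] : exists2 e' : R, 0 < e' & e'%:C + e'%:C = e.
  exists (complex.Re e / 2).
    by move: e0; rewrite ltcE /= => /andP[_ ?]; rewrite divr_gt0.
  by rewrite -rmorphD -splitr; apply/RRe_real/ger0_real/ltW.
have Xentry M a b : (exp_partial Phi A M) a b =
    series (fun j => complex.Re (u a b j)) M +i*
    series (fun j => complex.Im (u a b j)) M.
  rewrite /exp_partial summxE /series /= !big_mkord.
  apply/eqP; rewrite eq_complex /=; apply/andP; split; apply/eqP.
    by rewrite (raddf_sum (@complex.Re R)).
  by rewrite (raddf_sum (@complex.Im R)).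
have : \forall M \near \oo, forall a b,
    ball (L a b) e ((exp_partial Phi A M) a b : R[i]^o).
  apply: filter_forall => a; apply: filter_forall => b.
  have /cvgrPdist_lt/(_ e' e'0) nRe := cRe a b.
  have /cvgrPdist_lt/(_ e' e'0) nIm := cIm a b.
  near=> M.
  have dRe : `|limn (series (fun j => complex.Re (u a b j))) -
      series (fun j => complex.Re (u a b j)) M| < e' by near: M.
  have dIm : `|limn (series (fun j => complex.Im (u a b j))) -
      series (fun j => complex.Im (u a b j)) M| < e' by near: M.
  rewrite /ball /= mxE Xentry -ee'.
  set x := limn _; set y := limn _; set x' := series _ M; set y' := series _ M.
  have -> : (x +i* y) - (x' +i* y') = (x - x')%:C + 'i * (y - y')%:C.
    by simpc.
  rewrite (le_lt_trans (ler_normD _ _)) // normrM.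
  have -> : `|'i : R[i]| = 1.
    by rewrite normc_norm /normc expr0n expr1n add0r sqrtr1.
  by rewrite mul1r !normc_norm !normc_real ltrD // ltcR.
by apply: filterS => M XM; split.
Unshelve. all: by end_near. Qed.

(** The estimate passes to the limit entry by entry; summing the entries produces the factor
    [N * N]. *)
Lemma limn_exp_close A B k (d : R) :
  (forall M, (k <= M)%N -> mxnorm (exp_partial Phi A M - B) <= d) ->
  mxnorm (superop_exp Phi A - B) <= (N * N)%:R * d.
Proof.
move=> Bd; have /cvg_ballP Xlim := @exp_partial_cvg A.
have entry a b : normc ((superop_exp Phi A - B) a b) <= d.
  apply/ler_addgt0Pr => e e0.
  have /Xlim : 0 < (e%:C : R[i]) by rewrite ltcR.
  move=> XM.
  near \oo => M.
  have [_ /(_ a b)] : ball (limn (exp_partial Phi A : nat -> 'M[R[i]^o]_N)) e%:C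
      (exp_partial Phi A M : 'M[R[i]^o]_N) by near: M.
  rewrite /ball /= normc_norm ltcR => dX.
  have -> : (superop_exp Phi A - B) a b = (exp_partial Phi A M - B) a b +
      (superop_exp Phi A a b - exp_partial Phi A M a b).
    by rewrite !mxE; ring.
  rewrite (le_trans (normcD _ _)) // lerD ?(ltW dX) //.
  rewrite (le_trans (normc_le_mxnorm _ _ _)) // Bd //.
  by near: M; exact: nbhs_infty_ge.
rewrite /mxnorm.
rewrite (le_trans (ler_sum _ (fun a _ => ler_sum _ (fun b _ => entry a b)))) //.
by rewrite !sumr_const !card_ord -mulrnA mulr_natl.
Unshelve. all: by end_near. Qed.

End Exponential.

(** * Taylor truncation of the layers and of their composition *)

Section Layers.
Variables (R : realType) (n : nat).
Implicit Types (g : error_gen R n) (A B : 'M[R[i]]_(qdim n)).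

Definition layer_poly g (k : nat) (eps : R) A : 'M[R[i]]_(qdim n) :=
  exp_partial (fun B => eps%:C *: gen_map g B) A k.+1.

Lemma exp_coeff_scale (eps c : R) k j : 0 <= c -> `|eps| <= 1 -> (k <= j)%N ->
  exp_coeff (`|eps| * c) j <= `|eps| ^+ k * exp_coeff c j.
Proof.
move=> c0 eps1 kj; rewrite /exp_coeff /= exprMn -mulrA ler_wpM2r //.
  by rewrite mulr_ge0 ?exprn_ge0 // invr_ge0 ler0n.
by rewrite ler_wiXn2l.
Qed.

(** For [eps] of modulus at most 1, every term of the series beyond order [k] contains the factor
    [eps ^+ k.+1], and what remains is dominated by the exponential series at [c]. *)
Lemma layer_bounds g k : exists2 C : R, 0 <= C &
  forall (eps : R), `|eps| <= 1 -> forall A,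
    mxnorm (layer_poly g k eps A) <= C * mxnorm A /\
    mxnorm (error_channel g eps A - layer_poly g k eps A) <=
      C * `|eps| ^+ k.+1 * mxnorm A.
Proof.
have [c c0 gc] := linear_mxnorm_bound (gen_map g : {linear _ -> _}).
pose N2 : R := (qdim n * qdim n)%:R.
(* The summand 1 covers the bound on the truncation, and [N2] the factor from [limn_exp_close]. *)
exists ((1 + N2) * expR c).
  by rewrite mulr_ge0 ?expR_ge0 // addr_ge0 ?ler0n.
move=> eps eps1 A; set Phi := fun B => eps%:C *: gen_map g B.
have ec0 : 0 <= `|eps| * c by rewrite mulr_ge0.
have Phi_ec B : mxnorm (Phi B) <= (`|eps| * c) * mxnorm B.
  rewrite mxnormZ normc_real -mulrA; apply: ler_wpM2l => //; exact: gc.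
have Phi_c B : mxnorm (Phi B) <= c * mxnorm B.
  by rewrite (le_trans (Phi_ec B)) // ler_wpM2r ?mxnorm_ge0 // ler_piMl.
split.
  rewrite (le_trans (exp_partial_bound c0 Phi_c k.+1 A)) //.
  by rewrite ler_wpM2r ?mxnorm_ge0 // ler_peMl ?expR_ge0 // lerDl ler0n.
have tail M : (k.+1 <= M)%N ->
    mxnorm (exp_partial Phi A M - layer_poly g k eps A) <=
    expR c * `|eps| ^+ k.+1 * mxnorm A.
  move=> kM; rewrite /layer_poly /exp_partial -/Phi.
  rewrite -!(big_mkord xpredT (fun j => (j`!%:R^-1 : R[i]) *: iter j Phi A)).
  rewrite [X in X - _](@big_cat_nat _ _ _ k.+1) //=.
  rewrite addrAC subrr add0r.
  rewrite (le_trans (mxnorm_sum _ _ _)) //.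
  apply: (@le_trans _ _
    (\sum_(k.+1 <= j < M) `|eps| ^+ k.+1 * exp_coeff c j * mxnorm A)).
    apply: ler_sum_nat => j /andP[kj _].
    rewrite (le_trans (mxnorm_exp_term ec0 Phi_ec _ _)) //.
    by rewrite ler_wpM2r ?mxnorm_ge0 // exp_coeff_scale.
  rewrite -mulr_suml -mulr_sumr ler_wpM2r ?mxnorm_ge0 // mulrC.
  rewrite ler_wpM2r ?exprn_ge0 // (le_trans _ (series_exp_coeff_le c0 M)) //.
  rewrite -(big_mkord xpredT (exp_coeff c)).
  rewrite [X in _ <= X](@big_cat_nat _ _ _ k.+1) //= lerDr.
  by apply: sumr_ge0 => j _; apply: exp_coeff_ge0.
rewrite (le_trans (limn_exp_close ec0 Phi_ec tail)) // -/N2 !mulrA.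
rewrite ler_wpM2r ?mxnorm_ge0 // ler_wpM2r ?exprn_ge0 // ler_wpM2r ?expR_ge0 //.
by rewrite lerDr.
Qed.

Lemma iter_linear (f : {linear 'M[R[i]]_(qdim n) -> 'M[R[i]]_(qdim n)}) j A B :
  iter j f (A - B) = iter j f A - iter j f B.
Proof. by elim: j => //= j ->; rewrite linearB. Qed.

Lemma layer_polyB g k eps A B :
  layer_poly g k eps (A - B) = layer_poly g k eps A - layer_poly g k eps B.
Proof.
rewrite /layer_poly /exp_partial -sumrB; apply: eq_bigr => j _.
by rewrite (iter_linear (eps%:C \*: gen_map g)) scalerBr.
Qed.

Lemma adj_layer_poly g k eps A :
  adjmx (layer_poly g k eps A) = layer_poly g k eps (adjmx A).
Proof.
rewrite /layer_poly /exp_partial adjmx_sum; apply: eq_bigr => j _.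
rewrite adjmxZ conjc_inv conjc_nat; congr (_ *: _).
by elim: (j : nat) => //= l <-; rewrite adjmxZ adj_gen_map conjc_real.
Qed.

(** All terms after the first lie in the traceless image of the generator. *)
Lemma trace_layer_poly g k eps A : \tr (layer_poly g k eps A) = \tr A.
Proof.
rewrite /layer_poly /exp_partial big_ord_recl /= fact0 invr1 scale1r mxtraceD.
rewrite linear_sum big1 ?addr0 // => j _.
by rewrite linearZ /= mxtraceZ trace_gen_map !mulr0.
Qed.

Variables (psi : 'cV[R[i]]_(qdim n)) (I : pred (pauli n)).

Lemma word_poly_layer g k W : gen_within I g -> word_poly psi I W ->
  word_poly psi I (fun eps => layer_poly g k eps (W eps)).
Proof.
move=> gI WP; apply: (@word_poly_sum _ _ _ _ k.+1 (fun j eps =>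
  (j`!%:R^-1 : R[i]) *: iter j (fun B => eps%:C *: gen_map g B) (W eps))) => j.
apply: word_polyZ; elim: j => [//|j IHj] /=.
exact: (word_poly_gen gI IHj).
Qed.

(** The bound on [W] is carried along because the truncation error of the next layer is proportional
    to the size of its input. *)
Definition approximates k (W sigma : R -> 'M[R[i]]_(qdim n)) : Prop :=
  exists C : R, forall eps : R, `|eps| <= 1 ->
    mxnorm (W eps) <= C /\ mxnorm (sigma eps - W eps) <= C * `|eps| ^+ k.+1.

Lemma circuit_channel_poly k (G : seq (error_gen R n)) W sigma :
  (forall g, g \in G -> gen_within I g) ->
  word_poly psi I W -> (forall eps, adjmx (W eps) = W eps) ->
  (forall eps, \tr (W eps) = 1) -> approximates k W sigma ->
  exists V, [/\ word_poly psi I V, forall eps, adjmx (V eps) = V eps,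
    forall eps, \tr (V eps) = 1 &
    approximates k V (fun eps => circuit_channel G eps (sigma eps))].
Proof.
elim: G W sigma => [|g G IHG] W sigma GI WP Wadj Wtr [C WC].
  by exists W; split=> //; exists C.
have [D D0 gD] := layer_bounds g k.
apply: (IHG (fun eps => layer_poly g k eps (W eps))
  (fun eps => error_channel g eps (sigma eps))).
- by move=> h hG; apply: GI; rewrite inE hG orbT.
- by apply: word_poly_layer => //; apply: GI; rewrite mem_head.
- by move=> eps; rewrite adj_layer_poly Wadj.
- by move=> eps; rewrite trace_layer_poly.
have C0 : 0 <= C.
  have [|W0 _] := WC 0; first by rewrite normr0.
  exact: le_trans (mxnorm_ge0 _) W0.
(* Two of the three parts come from truncating the layer on an input of norm at most [C * 2], the
   third from the earlier error passed through the truncated layer. *)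
exists (D * C * 3) => eps eps1; have [Wb Wd] := WC _ eps1.
have [Lb _] := gD _ eps1 (W eps); have [Lb' _] := gD _ eps1 (sigma eps - W eps).
have [_ Ld] := gD _ eps1 (sigma eps).
have e0 : 0 <= `|eps| ^+ k.+1 by rewrite exprn_ge0.
have e1 : `|eps| ^+ k.+1 <= 1 by rewrite exprn_ile1.
have DC0 : 0 <= D * C by rewrite mulr_ge0.
split.
  rewrite (le_trans Lb) // (le_trans (ler_wpM2l D0 Wb)) //.
  by rewrite ler_peMr // ler1n.
have sb : mxnorm (sigma eps) <= C * 2.
  rewrite -[sigma eps](subrK (W eps)) (le_trans (mxnormD _ _)) //.
  rewrite mulr_natr mulr2n lerD // (le_trans Wd) // ler_piMr //.
rewrite -[error_channel _ _ _](subrK (layer_poly g k eps (sigma eps))).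
rewrite -addrA -layer_polyB (le_trans (mxnormD _ _)) //.
rewrite (_ : D * C * 3 * _ = D * `|eps| ^+ k.+1 * (C * 2) +
  D * (C * `|eps| ^+ k.+1)); last by ring.
rewrite lerD //.
  by rewrite (le_trans Ld) // ler_wpM2l // mulr_ge0.
by rewrite (le_trans Lb') // ler_wpM2l.
Qed.

End Layers.

(** * Order-k detector error models *)

Section PolynomialAsymptotics.
Variable R : realType.
Implicit Types (f h : {poly R}) (x : R).

Lemma horner_le_coef f x : `|x| <= 1 -> `|f.[x]| <= \sum_(j < size f) `|f`_j|.
Proof.
move=> x1; rewrite horner_coef (le_trans (ler_norm_sum _ _ _)) //.
rewrite ler_sum // => j _.
by rewrite normrM ler_piMr // normrX exprn_ile1.
Qed.

Lemma bigO_pow (f : R -> R) (C : R) k :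
  (forall x, `|x| <= 1 -> `|f x| <= C * `|x| ^+ k) ->
  (f : R -> R^o) =O_ (nbhs (0 : R)) (fun x : R => x ^+ k : R^o).
Proof.
move=> fC; apply/eqO_exP; exists (`|C| + 1); first by rewrite addrC ltr_pwDl.
near=> x; have x1 : `|x| <= 1.
  by near: x; apply: (@nbhs0_le _ R^o).
rewrite (le_trans (fC x x1)) // normrX ler_wpM2r ?exprn_ge0 //.
by rewrite (le_trans (ler_norm C)) // lerDl.
Unshelve. all: by end_near. Qed.

Lemma bigO_powP (f : R -> R) k :
  (f : R -> R^o) =O_ (nbhs (0 : R)) (fun x : R => x ^+ k : R^o) ->
  exists C : R, \forall x \near nbhs (0 : R), `|f x| <= C * `|x| ^+ k.
Proof.
move=> /eqO_exP[C _ fC]; exists C; apply: filterS fC => x /=.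
by rewrite normrX.
Qed.

Lemma dvdXn_bigO f k : 'X^k %| f -> exists C : R,
  forall x, `|x| <= 1 -> `|f.[x]| <= C * `|x| ^+ k.
Proof.
move=> /dvdpP[h ->]; exists (\sum_(j < size h) `|h`_j|) => x x1.
by rewrite hornerM hornerXn normrM normrX ler_wpM2r ?exprn_ge0 ?horner_le_coef.
Qed.

(** Powers of ['X] are split off one at a time: if [f] is [h] times ['X^j] with [j < k], the
    estimate makes [h] tend to 0 at 0, so its constant term vanishes. *)
Lemma bigO_dvdXn f k (C : R) :
  (\forall x \near nbhs (0 : R), `|f.[x]| <= C * `|x| ^+ k) -> 'X^k %| f.
Proof.
move=> fC; suff Xj j : (j <= k)%N -> 'X^j %| f by exact: Xj.
elim: j => [|j IHj] jk; first by rewrite expr0 dvd1p.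
have /dvdpP[h fh] := IHj (ltnW jk).
suff h0 : h`_0 = 0.
  by rewrite fh exprS dvdp_mul // dvdX_coef0 h0.
have hX : h = drop_poly 1 h * 'X + (h`_0)%:P.
  rewrite -[LHS](poly_take_drop 1 h) expr1 [LHS]addrC; congr (_ + _).
  apply/polyP=> i; rewrite coef_take_poly coefC.
  by case: i.
pose D := \sum_(j < size (drop_poly 1 h)) `|(drop_poly 1 h)`_j|.
have D0 : 0 <= D by apply: sumr_ge0.
apply/eqP; rewrite -normr_eq0 eq_le normr_ge0 andbT.
apply/ler_addgt0Pr => e e0; rewrite add0r.
(* The constant term of [h] is at most [|C| + D] times [|x|]; the added 1 keeps [K] positive, so
   that [e / K] is a valid radius. *)
pose K := `|C| + D + 1.
have K0 : 0 < K by rewrite /K addrC ltr_pwDl // addr_ge0.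
(* The neighbourhood is punctured so that the power of [|x|] can be cancelled. *)
near (0 : R)^' => x.
have x0 : x != 0 by near: x; exact: nbhs_dnbhs_neq.
have x1 : `|x| <= 1.
  by near: x; apply: (@dnbhs0_le _ R^o).
have xe : `|x| <= e / K.
  by near: x; apply: (@dnbhs0_le _ R^o); rewrite divr_gt0.
have fx : `|f.[x]| <= C * `|x| ^+ k.
  by near: x; apply: nbhs_dnbhs.
have hx : `|h.[x]| <= `|C| * `|x|.
  have xj : 0 < `|x| ^+ j by rewrite exprn_gt0 // normr_gt0.
  rewrite -(ler_pM2r xj) -normrX -normrM -hornerXn -hornerM -fh.
  rewrite (le_trans fx) // hornerXn normrX -mulrA -exprS.
  rewrite (le_trans (ler_wpM2r (exprn_ge0 _ (normr_ge0 _)) (ler_norm C))) //.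
  by rewrite ler_wpM2l // ler_wiXn2l.
have -> : h`_0 = h.[x] - (drop_poly 1 h).[x] * x.
  by rewrite {2}hX hornerD hornerMX hornerC addrC addKr.
rewrite (le_trans (ler_normB _ _)) //.
rewrite (@le_trans _ _ (K * `|x|)) //; last by rewrite mulrC -ler_pdivlMr.
rewrite (@le_trans _ _ (`|C| * `|x| + D * `|x|)) //.
  by rewrite lerD // normrM ler_wpM2r // horner_le_coef.
by rewrite -mulrDl ler_wpM2r // lerDl.
Unshelve. all: by end_near. Qed.

End PolynomialAsymptotics.

(** * History probabilities as real polynomials *)

Section HistoryPolynomials.
Variables (R : realType) (n : nat) (DD : {set pauli n}).
Variable psi : 'cV[R[i]]_(qdim n).
Hypothesis psi1 : adjmx psi *m psi = 1%:M.
Hypothesis DDpsi : forall P, P \in DD -> detector psi P.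
Variable I : pred (pauli n).

Let E : {set {set pauli n}} := [set dem_event R DD P | P in I]%SET.

Lemma history_poly_Re W (S : {set pauli n}) :
  word_poly psi I W -> S \subset DD ->
  exists lam : {poly R}, supported E lam S /\
    forall eps, lam.[eps] = complex.Re (\tr (history_proj R DD S *m W eps)).
Proof.
move=> WP SDD; elim: WP => [|V V' _ [l [lS lV]] _ [l' [lS' lV']]|j A AS].
- exists 0; split=> [j|eps]; first by rewrite coef0 eqxx.
  by rewrite horner0 mulmx0 mxtrace0.
- exists (l + l'); split=> [|eps]; first exact: supportedD.
  by rewrite hornerD lV lV' mulmxDr mxtraceD raddfD.
set z := \tr (history_proj R DD S *m A).
exists ((complex.Re z)%:P * 'X^j); split=> [l|eps].
  rewrite coefCM coefXn; have [->|_] := eqVneq l j; last by rewrite mulr0 eqxx.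
  rewrite mulr1 => zn0; apply: (trace_history_span psi1 DDpsi AS SDD).
  by apply: contraNneq zn0 => z0; rewrite /z z0.
rewrite hornerCM hornerXn -scalemxAr mxtraceZ -/z -rmorphXn /=.
by case: z => a b /=; rewrite mul0r subr0 mulrC.
Qed.

Lemma sum_trace_history_poly W eps : word_poly psi I W ->
  \sum_(S : {set pauli n} | S \subset DD)
    \tr (history_proj R DD S *m W eps) = \tr (W eps).
Proof.
elim=> [|V V' _ IHV _ IHV'|j A AS].
- by rewrite mxtrace0 big1 // => S _; rewrite mulmx0 mxtrace0.
- rewrite mxtraceD -IHV -IHV' -big_split; apply: eq_bigr => S _.
  by rewrite mulmxDr mxtraceD.
rewrite mxtraceZ -(sum_trace_history_span psi1 DDpsi AS) mulr_sumr.
by apply: eq_bigr => S _; rewrite -scalemxAr mxtraceZ.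
Qed.

Lemma conj_trace_history_poly W eps (S : {set pauli n}) :
  word_poly psi I W -> S \subset DD ->
  conjc (\tr (history_proj R DD S *m W eps)) =
  \tr (history_proj R DD S *m adjmx (W eps)).
Proof.
move=> WP SDD; elim: WP => [|V V' _ IHV _ IHV'|j A AS].
- by rewrite /adjmx map_mx0 trmx0 mulmx0 mxtrace0 conjc0.
- by rewrite adjmxD !mulmxDr !mxtraceD rmorphD /= IHV IHV'.
rewrite adjmxZ -!scalemxAr !mxtraceZ rmorphM /=.
by rewrite (conj_trace_history_span psi1 DDpsi AS).
Qed.

Lemma history_poly_exists W : word_poly psi I W ->
  (forall eps, adjmx (W eps) = W eps) -> (forall eps, \tr (W eps) = 1) ->
  exists lam : {set pauli n} -> {poly R},
  [/\ forall S : {set pauli n}, S \subset DD -> supported E (lam S) S,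
      forall S : {set pauli n}, S \subset DD -> forall eps,
        (lam S).[eps]%:C = \tr (history_proj R DD S *m W eps)
    & \sum_(S : {set pauli n} | S \subset DD) lam S = 1].
Proof.
move=> WP Wadj Wtr.
have /choice[lam lamP] : forall S : {set pauli n}, exists l : {poly R},
    S \subset DD -> supported E l S /\ forall eps,
      l.[eps] = complex.Re (\tr (history_proj R DD S *m W eps)).
  move=> S.
  have [SDD|nSDD] := boolP (S \subset DD); last by exists 0.
  by have [l lP] := history_poly_Re WP SDD; exists l.
have real_tr (S : {set pauli n}) eps : S \subset DD ->
    (complex.Re (\tr (history_proj R DD S *m W eps)))%:C =
    \tr (history_proj R DD S *m W eps).
  move=> SDD; have := conj_trace_history_poly eps WP SDD; rewrite Wadj.
  case: (\tr _) => a b [bE]; congr (_ +i* _); lra.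
(* The values of the [lam S] sum to 1 at every [eps]. Redefining the polynomial of the empty history
   makes the sum 1 as polynomials, keeps all values, and is harmless for [supported]. *)
pose lam' (S : {set pauli n}) : {poly R} := if S == finset.set0 then
  1 - \sum_(S : {set pauli n} | (S \subset DD) && (S != finset.set0)) lam S
  else lam S.
have sum1 eps : \sum_(S : {set pauli n} | S \subset DD)
    complex.Re (\tr (history_proj R DD S *m W eps)) = 1.
  by rewrite -raddf_sum sum_trace_history_poly // Wtr.
have lam'E (S : {set pauli n}) : S != finset.set0 -> lam' S = lam S.
  by rewrite /lam' => /negPf->.
exists lam'; split=> [S SDD|S SDD eps|].
- have [->|/lam'E->] := eqVneq S finset.set0; first exact: supported_set0.
  by have [] := lamP S SDD.
- rewrite -real_tr //; congr (_%:C).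
  have [->|/lam'E->] := eqVneq S finset.set0; last by have [_ ->] := lamP S SDD.
  rewrite /lam' eqxx hornerD hornerN hornerC horner_sum -(sum1 eps).
  rewrite (bigD1 finset.set0) ?finset.sub0set //= -addrA.
  rewrite [X in _ + X](_ : _ = 0) ?addr0 // -sumrB big1 // => A /andP[ADD _].
  by have [_ ->] := lamP A ADD; rewrite subrr.
rewrite (bigD1 finset.set0) ?finset.sub0set //= {1}/lam' eqxx.
rewrite [X in _ + X](eq_bigr lam) ?subrK // => S /andP[_].
exact: lam'E.
Qed.

End HistoryPolynomials.

Section OrderDem.
Variables (R : realType) (n : nat) (DD : {set pauli n}).
Local Notation normc := Normc.normc.

Lemma eventsP (S : {set pauli n}) :
  (S \in events DD) = (S != finset.set0) && (S \subset DD).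
Proof. by rewrite !inE. Qed.

Lemma horner_dem_value (p : {set pauli n} -> {poly R}) S eps :
  (dem_value (events DD) p S).[eps] = dem_prob DD (fun D => (p D).[eps]) S.
Proof.
rewrite /dem_value horner_sum; apply: eq_bigr => F _.
rewrite hornerM !horner_prod; congr (_ * _); apply: eq_bigr => D _.
by rewrite hornerD hornerN hornerC.
Qed.

Variables (psi : 'cV[R[i]]_(qdim n)) (G : seq (error_gen R n)).

(** The truncated circuit yields exact polynomials; since the trace against a projector is a bounded
    linear functional, the matrix error carries over to the probabilities. *)
Lemma history_prob_approx (I : pred (pauli n)) k : adjmx psi *m psi = 1%:M ->
  (forall P, P \in DD -> detector psi P) ->
  (forall g, g \in G -> gen_within I g) ->
  exists lam : {set pauli n} -> {poly R},
  [/\ forall S : {set pauli n}, S \subset DD ->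
        supported [set dem_event R DD P | P in I]%SET (lam S) S,
      \sum_(S : {set pauli n} | S \subset DD) lam S = 1
    & forall S : {set pauli n}, S \subset DD ->
        exists C : R, forall eps, `|eps| <= 1 ->
        normc ((lam S).[eps]%:C - history_prob psi DD G eps S) <=
        C * `|eps| ^+ k.+1].
Proof.
move=> psi1 DDpsi GI; pose rho := psi *m adjmx psi.
have [V [VP Vadj Vtr [C VC]]] : exists V, [/\ word_poly psi I V,
    forall eps, adjmx (V eps) = V eps, forall eps, \tr (V eps) = 1 &
    approximates k V (fun eps => circuit_channel G eps rho)].
  apply: (@circuit_channel_poly _ _ psi I k G (fun=> rho) (fun=> rho)) => //.
  - rewrite (_ : (fun=> rho) = fun eps : R => eps%:C ^+ 0 *:
      (word_mx R [::] *m rho *m word_mx R [::])).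
      exact/WordPolyX/WordSpanGen.
    by apply: funext => eps; rewrite scale1r mulmx1 mul1mx.
  - by move=> eps; exact: adj_state.
  - by move=> eps; exact: trace_state.
  exists (mxnorm rho) => eps _; rewrite subrr mxnorm0; split=> //.
  by rewrite mulr_ge0 ?mxnorm_ge0 // exprn_ge0.
have [lam [lamS lamV lam1]] := history_poly_exists psi1 DDpsi VP Vadj Vtr.
exists lam; split=> // S SDD.
(* A 1 x 1 matrix, so that [linear_mxnorm_bound] applies. *)
pose f := fun A : 'M[R[i]]_(qdim n) =>
  (\tr (history_proj R DD S *m A))%:M : 'M[R[i]]_1.
have f_lin : linear f.
  move=> c A B; rewrite /f mulmxDr -scalemxAr mxtraceD mxtraceZ.
  by rewrite raddfD /= scale_scalar_mx.
pose fL : {linear 'M[R[i]]_(qdim n) -> 'M[R[i]]_1} :=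
  HB.pack f (GRing.isLinear.Build _ _ _ _ f f_lin).
have [K K0 fK] := linear_mxnorm_bound fL.
exists (K * C) => eps eps1; have [_ VC1] := VC _ eps1.
rewrite lamV // /history_prob -/rho -mulrA.
rewrite (le_trans _ (ler_wpM2l K0 VC1)) // (le_trans _ (fK _)) //.
rewrite (le_trans _ (normc_le_mxnorm _ 0 0)) // /fL /= /f mxE eqxx mulr1n.
rewrite -normcN opprB mulmxBr.
by rewrite (raddfB (@mxtrace R[i] (qdim n))).
Qed.

End OrderDem.

Theorem theorem2 (R : realType) (n m : nat) (psi : 'cV[R[i]]_(qdim n))
    (DD : {set pauli n}) (G : m.-tuple (error_gen R n)) :
  stabilizer_state psi -> detector_set psi DD ->
  forall k : nat, (1 <= k)%N ->
  exists p : {set pauli n} -> {poly R},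
    [/\ order_dem psi DD G k p,
        forall q : {set pauli n} -> {poly R}, order_dem psi DD G k q ->
          forall D : {set pauli n}, D \in events DD -> q D = p D
      & forall D : {set pauli n}, D \in events DD ->
          D \notin elem_events_upto DD G k -> p D = 0%R].
Proof.
move=> [psi1 _] [DDpsi _ _] k _.
(* This is the predicate inside [elem_events], so the image of [I] under [dem_event] is
   [elem_events DD G] by conversion. *)
pose I := [pred P : pauli n | has (fun g : error_gen R n =>
  [exists e : elem_gen n, (g e != 0) && (P \in indices (val e))]) G].
have GI g : g \in (G : seq _) -> gen_within I g.
  move=> gG e ge P Pe; apply/hasP; exists g => //.
  by apply/existsP; exists e; rewrite ge.
have [lam [lamS lam1 lamP]] := history_prob_approx k psi1 DDpsi GI.
have ev0 : finset.set0 \notin events DD by rewrite eventsP eqxx.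
have evDD D : D \in events DD -> D \subset DD by rewrite eventsP => /andP[].
have [p pP] := dem_value_exists ev0 k (fun S Sev => lamS S (evDD S Sev)).
(* Any order-[k] model and [lam] approximate the same probabilities, so their difference is a
   polynomial of order [eps ^+ k.+1] and hence divisible by ['X^(k.+1)]. *)
have dvd_lam (q : {set pauli n} -> {poly R}) (S : {set pauli n}) :
    order_dem psi DD G k q -> S \subset DD ->
    'X^(k.+1) %| dem_value (events DD) q S - lam S.
  move=> [_ qO] SDD; have [C lamC] := lamP S SDD.
  have [K qK] := bigO_powP (qO S SDD).
  apply: (@bigO_dvdXn _ _ _ (K + C)).
  near=> x.
  have x1 : `|x| <= 1 by near: x; apply: (@nbhs0_le _ R^o).
  have qx : `|Normc.normc ((dem_prob DD (fun D => (q D).[x]) S)%:C -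
      history_prob psi DD G x S)| <= K * `|x| ^+ k.+1.
    by near: x.
  rewrite hornerD hornerN horner_dem_value mulrDl -normc_real.
  set a := dem_prob _ _ _; set b := (lam S).[x].
  pose h := history_prob psi DD G x S.
  have -> : (a - b)%:C = (a%:C - h) - (b%:C - h).
    by rewrite opprB addrA subrK rmorphB.
  rewrite (le_trans (normcD _ _)) // lerD //.
    by rewrite (le_trans _ qx) // ler_norm.
  by rewrite normcN lamC.
(* The fixed point controls nonempty histories only. The empty one follows from normalisation: both
   families sum to 1, so its discrepancy is minus the sum of the others. *)
have p_dvd (S : {set pauli n}) : S \subset DD ->
    'X^(k.+1) %| dem_value (events DD) p S - lam S.
  have pev (A : {set pauli n}) : A \subset DD -> A != finset.set0 ->
      'X^(k.+1) %| dem_value (events DD) p A - lam A.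
    by move=> ADD A0; have [] := pP A; rewrite ?eventsP ?A0.
  move=> SDD; have [->|] := eqVneq S finset.set0; last exact: pev.
  have : \sum_(A : {set pauli n} | A \subset DD)
      (dem_value (events DD) p A - lam A) = 0.
    by rewrite sumrB lam1 sum_dem_value ?subrr.
  rewrite (bigD1 finset.set0) ?finset.sub0set //= => /eqP.
  rewrite addr_eq0 => /eqP ->; rewrite dvdpNr.
  elim/big_ind: _ => [||A /andP[ADD]]; first exact: dvdp0.
    by move=> x y; apply: dvdp_add.
  exact: pev.
exists p; split.
- split=> [D Dev|S SDD].
    have [sp Xp _ _] := pP D Dev; split=> //.
    by rewrite horner_coef0; apply/eqP; rewrite -dvdX_coef0.
  have [C lamC] := lamP S SDD; have [K pK] := dvdXn_bigO (p_dvd S SDD).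
  apply: (bigO_pow (C := K + C)) => x x1.
  rewrite ger0_norm ?normc_ge0 // mulrDl -(subrKA ((lam S).[x]%:C)).
  rewrite (le_trans (normcD _ _)) // lerD ?lamC //.
  by rewrite -rmorphB normc_real -horner_dem_value -hornerN -hornerD pK.
- move=> q qdem D Dev.
  apply: (dem_value_inj ev0 (k := k)) Dev => // [A Aev|A Aev|A Aev].
  + have [/(_ A Aev)[sq q0] _] := qdem.
    by split=> //; rewrite dvdX_coef0 -horner_coef0 q0.
  + by have [] := pP A Aev.
  (* Uniqueness: both models have values congruent to [lam A], hence to each other. *)
  rewrite -(subrKA (lam A)) dvdp_add ?dvd_lam ?evDD //.
  by rewrite -opprB dvdpNr p_dvd ?evDD.
move=> D Dev DE; have [sp _ pS _] := pP D Dev.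
apply/polyP=> j; rewrite coef0; apply/eqP/negPn/negP => pj.
(* A nonzero coefficient of order [j] puts [D] in level [j], and the size bound gives [j <= k]. *)
case/negP: DE; apply: (symdiffs_uptoW _ (pS j pj)).
by rewrite -ltnS (leq_trans _ sp) // ltnNge; apply: contra pj => /leq_sizeP ->.
Unshelve. all: by end_near. Qed.
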